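(* Let $n$ be a positive integer, $0\le n_0\le n$ an integer, $a=(a_1,\dots,a_n)$ a sequence of positive integers, $v=(v_1,\dots,v_n)\in\mathbb{Z}^n$ and $\lambda$ a partition with $|\lambda|=|v|$. Define $r:=\max\big(\{v_i-n+n_0: i\le n_0\}\cup\{v_i: i\ge n_0+1\}\big)$, $S_1:=\{i: 1\le i\le n_0,\ v_i-n+n_0=r\}$, $S_2:=\{i: n_0+1\le i\le n,\ v_i=r\}$, $s_1:=|S_1|$, $s_2:=|S_2|$, and $\widetilde a:=(a_1-1,\dots,a_{n_0}-1,a_{n_0+1},\dots,a_n)$. \begin{enumerate} \item If $\max\{v_i-n+n_0: i\le n_0\}\ge\max\{v_i: i\ge n_0+1\}+s_1$ and $\lambda_1=\cdots=\lambda_{s_1}=r$, then \[ D_{v,\lambda}(a;n,n_0)=(-1)^{s_1(n-n_0)}\frac{\begin{bmatrix}|\widetilde a|+r-1\\ \widetilde a,\,r-1\end{bmatrix}}{\begin{bmatrix}|\widetilde a|-\widetilde a_{S_1}+r-1\\ \widetilde a^{(S_1)},\,r-1\end{bmatrix}}\sum_{\emptyset\ne J\subseteq S_1}(-1)^{|S_1\setminus J|}q^{L_{n_0,S_1,J}(\widetilde a)}\frac{1-q^{\widetilde a_J}}{1-q^{|\widetilde a|-\widetilde a_J+r}}\,D_{(v+s_1\alpha)^{(S_1)},\lambda^{([s_1])}}\big(a^{(S_1)};n-s_1,n_0-s_1\big), \] where $\alpha=(0,\dots,0,1,\dots,1)$ has $n_0$ zeros followed by $n-n_0$ ones. \item If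 $\max\{v_i: i\ge n_0+1\}\ge\max\{v_i-n+n_0: i\le n_0\}+s_2$ and $\lambda_1=\cdots=\lambda_{s_2}=r$, then \[ D_{v,\lambda}(a;n,n_0)=\frac{\begin{bmatrix}|\widetilde a|+r-1\\ \widetilde a,\,r-1\end{bmatrix}}{\begin{bmatrix}|\widetilde a|-\widetilde a_{S_2}+r-1\\ \widetilde a^{(S_2)},\,r-1\end{bmatrix}}\sum_{\emptyset\ne J\subseteq S_2}(-1)^{|S_2\setminus J|}q^{L_{n,S_2,J}(\widetilde a)}\frac{1-q^{\widetilde a_J}}{1-q^{|\widetilde a|-\widetilde a_J+r}}\,D_{v^{(S_2)},\lambda^{([s_2])}}\big(a^{(S_2)};n-s_2,n_0\big). \end{enumerate}
   Context: For a nonnegative integer $k$, $(z)_k:=(1-z)(1-zq)\cdots(1-zq^{k-1})$. For $N$ and a nonnegative integer sequence $t=(t_1,\dots,t_k)$, the $q$-multinomial coefficient is $\begin{bmatrix}N\\ t\end{bmatrix}:=(q)_N/\big((q)_{t_1}\cdots(q)_{t_k}\big)$; $\begin{bmatrix}N\\ \widetilde a, r-1\end{bmatrix}$ means $t$ is the sequence $\widetilde a$ followed by $r-1$. For a sequence $s=(s_1,\dots,s_n)$ and $I\subseteq\{1,\dots,n\}$, $s^{(I)}$ is the sequence obtained from $s$ by deleting the entries with indices in $I$, $s_I:=\sum_{i\in I}s_i$, and $|s|$ is the sum of all entries. $[m]=\{1,\dots,m\}$, so $\lambda^{([s])}=(\lambda_{s+1},\lambda_{s+2},\dots)$. For $m$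 a positive integer, a sequence $b$ and $I,J\subseteq\{1,\dots,n\}$, $L_{m,I,J}(b):=\sum b_j$, the sum over pairs $(i,j)$ with $1\le i\le j\le m$, $i\in I$, $j\notin J$. A partition is a weakly decreasing sequence of nonnegative integers with finitely many nonzero entries. Complete symmetric functions: $\sum_{r\ge0}z^rh_r(X)=\prod_{x\in X}(1-zx)^{-1}$, $h_\lambda:=h_{\lambda_1}h_{\lambda_2}\cdots$. For positive integers $a=(a_1,\dots,a_n)$ and $0\le n_0\le n$, let $X^{(a;n_0)}=\{x_iq^{k}: 1\le i\le n_0,\ 0\le k\le a_i-2\}\cup\{x_iq^k: n_0+1\le i\le n,\ 0\le k\le a_i-1\}$, and with $\chi(i\le n_0)=1$ if $i\le n_0$ and $0$ otherwise, for $v\in\mathbb{Z}^n$ and a partition $\lambda$ with $|\lambda|=|v|$ define \[ D_{v,\lambda}(a;n,n_0):=\operatorname{CT}_{x}\; x^{-v}\,h_\lambda\big(X^{(a;n_0)}\big)\prod_{1\le i<j\le n}(x_i/x_j)_{a_i-\chi(i\le n_0)}(qx_j/x_i)_{a_j-\chi(i\le n_0)}, \] where $x^{-v}=x_1^{-v_1}\cdots x_n^{-v_n}$ and $\operatorname{CT}_x$ is the constant term in $x_1,\dots,x_n$.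
   Formalization: The formal theorem assumes r ≥ 1; for r = 0, the only other value λ_1 = r allows, the q-multinomial coefficients with entry r−1 = −1 are undefined. *)

(* Defs.v *)
From Stdlib Require Import ClassicalEpsilon.
From mathcomp Require Import all_boot all_order all_algebra.
From mathcomp.multinomials Require Import mpoly.

Set Implicit Arguments.
Unset Strict Implicit.
Unset Printing Implicit Defensive.

Import GRing.Theory.
Local Open Scope ring_scope.

(* (z)_k in base q *)
Definition qpoch (R : pzRingType) (q z : R) (k : nat) : R :=
  \prod_(i < k) (1 - z * q ^+ i).

Definition qmultinomial (F : fieldType) (q : F) (N : nat) (t : seq nat) : F :=
  qpoch q q N / \prod_(k <- t) qpoch q q k.

(* The coefficient of z^r in the product of the (1 - z x)^-1 for x in the
   multiset X: the geometric series are cut after z^r, which does not affect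
   that coefficient. *)
Definition complete_sym (R : comNzRingType) (X : seq R) (r : nat) : R :=
  (\prod_(x <- X) \sum_(k < r.+1) (x *: 'X) ^+ k)`_r.

Definition complete_sym_part (R : comNzRingType) (X : seq R) (la : seq nat) : R :=
  \prod_(l <- la) complete_sym X l.

(* Laurent polynomials in x_1, .., x_n over F are taken inside the field of
   rational functions: f is one when f * x^m is a polynomial p for some
   monomial x^m, and its constant term is then the coefficient of x^m in p,
   whatever the choice of m and p (lemma CT_laurent). *)
Definition CT (F : fieldType) (n : nat) (f : {fraction {mpoly F[n]}}) : F :=
  let pm := epsilon (inhabits (0, 0%MM))
    (fun pm : {mpoly F[n]} * 'X_{1..n} => f * tofrac 'X_[pm.2] = tofrac pm.1) in
  pm.1@_(pm.2).

Section Dyson.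

Variables (F : fieldType) (q : F).

Definition fvar (n : nat) (i : 'I_n) : {fraction {mpoly F[n]}} := tofrac 'X_i.

Definition fconst (n : nat) (c : F) : {fraction {mpoly F[n]}} := tofrac c%:MP.

Definition alphabet (n n0 : nat) (a : seq nat) : seq {fraction {mpoly F[n]}} :=
  [seq fvar i * fconst n q ^+ k | i <- enum 'I_n, k <- iota 0 (nth 0 a i - (i < n0))].

(* Indices start at 0, so that i < n0 stands for i <= n_0.  The sequences a and
   v are meant to have size n. *)
Definition dysonD (n n0 : nat) (a : seq nat) (v : seq int) (la : seq nat) : F :=
  CT (\prod_(i < n) fvar i ^ (- v`_i)
      * complete_sym_part (alphabet n n0 a) la
      * \prod_(i < n) \prod_(j < n | (i < j)%N)
          (qpoch (fconst n q) (fvar i / fvar j) (nth 0 a i - (i < n0))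
           * qpoch (fconst n q) (fconst n q * fvar j / fvar i) (nth 0 a j - (i < n0)))).

End Dyson.

Definition delete (T : Type) (n : nat) (S : {set 'I_n}) (s : n.-tuple T) : seq T :=
  [seq tnth s i | i <- enum (~: S)].

Definition subsum (n : nat) (S : {set 'I_n}) (s : n.-tuple nat) : nat :=
  \sum_(i in S) tnth s i.

(* Indices start at 0, so that j < m stands for j <= m. *)
Definition Lsum (n m : nat) (I J : {set 'I_n}) (b : n.-tuple nat) : nat :=
  \sum_(i in I) \sum_(j < n | [&& (i <= j)%N, (j < m)%N & j \notin J]) tnth b j.

Lemma CT_laurent (F : fieldType) (n : nat) (p : {mpoly F[n]}) (m : 'X_{1..n}) :
  CT (tofrac p / tofrac 'X_[m]) = p@_m.
Proof.
have X0 k : tofrac 'X_[k] != 0 :> {fraction {mpoly F[n]}}.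
  rewrite tofrac_eq0; apply/eqP => /(congr1 (mcoeff k)) /eqP.
  by rewrite mcoeffX eqxx mcoeff0 oner_eq0.
rewrite /CT; set P := (fun pm : _ * _ => _); set d := inhabits _.
have : P (epsilon d P) by apply: epsilon_spec; exists (p, m); rewrite /P /= divfK.
case: (epsilon d P) => p' m' /=.
rewrite /P /= mulrAC => /(canRL (divfK (X0 m))) /eqP.
rewrite -!rmorphM tofrac_eq => /eqP E.
by rewrite -(mcoeffMX p' m m') -E [in LHS]addmC mcoeffMX.
Qed.

Lemma complete_sym_gen (R : comNzRingType) (X : seq R) (N r : nat) :
  (r < N)%N ->
  (\prod_(x <- X) (1 - x *: 'X) * \poly_(k < N) complete_sym X k)`_r
  = (r == 0%N)%:R.
Proof.
pose eqm M (p s : {poly R}) := forall k, (k <= M)%N -> p`_k = s`_k.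
have eqmM M p p' s s' : eqm M p p' -> eqm M s s' -> eqm M (p * s) (p' * s').
  move=> ep es k kM; rewrite !coefM; apply: eq_bigr => i _.
  by rewrite ep ?es // (leq_trans _ kM) ?leq_subr // -ltnS.
have eqm_prod M f g : (forall x, eqm M (f x) (g x)) ->
    eqm M (\prod_(x <- X) f x) (\prod_(x <- X) g x).
  by move=> e; apply: (big_ind2 (eqm M)) => //; exact: eqmM.
pose geo M (x : R) : {poly R} := \sum_(k < M.+1) (x *: 'X) ^+ k.
have geoE M x k : (k <= M)%N -> (geo M x)`_k = x ^+ k.
  move=> kM; rewrite coef_sum (bigD1 (Ordinal (kM : k < M.+1)%N)) //= big1 => [|i].
    by rewrite exprZn coefZ coefXn eqxx mulr1 addr0.
  rewrite -val_eqE /= => ik.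
  by rewrite exprZn coefZ coefXn eq_sym (negPf ik) mulr0.
have csE M k : (k <= M)%N -> complete_sym X k = (\prod_(x <- X) geo M x)`_k.
  move=> kM; apply: (eqm_prod k _ _ _ k (leqnn k)) => x j jk.
  by rewrite !geoE // (leq_trans jk).
have inv M x : eqm M ((1 - x *: 'X) * geo M x) 1.
  move=> k kM; rewrite mulrBl mul1r -scalerAl coefB coefZ coefXM geoE // coef1.
  case: k kM => [|k] kM /=; first by rewrite mulr0 subr0.
  by rewrite geoE ?(ltnW kM) // -exprS subrr.
move=> rN; have eP : eqm r (\poly_(k < N) complete_sym X k) (\prod_(x <- X) geo r x).
  by move=> k kr; rewrite coef_poly (leq_ltn_trans kr rN) (csE r).
rewrite (eqmM r _ _ _ _ (fun k _ => erefl) eP r) // -big_split /=.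
by rewrite (eqm_prod r _ (fun=> 1) (inv r) r) // big1_eq coef1.
Qed.

(* Main.v *)
Require Import Defs.
From mathcomp Require Import all_boot all_order all_algebra.
From mathcomp.multinomials Require Import mpoly.
From mathcomp Require Import constructive_ereal.
From mathcomp Require Import ring zify.

Set Implicit Arguments.
Unset Strict Implicit.
Unset Printing Implicit Defensive.

Import Order.TTheory GRing.Theory Num.Theory.
Local Open Scope ring_scope.

(* In terms of the sequence b = (a_i - chi(i <= n_0)), X is the alphabet of the
   letters x_i q^k with k < b_i, and partial fractions give
   h_r(X) = sum_(i, k) (x_i q^k)^r / prod_(y != x_i q^k) (1 - y / (x_i q^k)).
   The denominators of the (i, k) term cancel against the q-Dyson product: what
   remains is a polynomial in x_i, divisible by x_i to the number of crossing
   pairs (i, l), i <= n_0 < l, whose pair factor is one factor short.  So the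
   term contributes to the constant term only when v_i is at least r (plus that
   number), and in the case of equality the constant term in x_i is obtained by
   putting x_i = 0, which deletes the variable.  Summing over k produces a
   q-binomial coefficient.  Iterating over S expresses D as D with S deleted
   times a sum over the orderings of S; the latter satisfies the same recursion
   as the sum over J, again by partial fractions, a telescoping sum, and a
   sign-reversing involution. *)

(** * Complete symmetric functions *)

(** The gap of [s1] or [s2] between the two maxima keeps the other block of indices out of reach
    during the whole elimination. A crossing pair leaves a factor [- x_i / x_l]. In the first case
    each deletion therefore raises every exponent [v_l] with [l > n_0] by 1; in the second each
    deletion removes one crossing pair of every [i <= n_0] and so lowers the threshold for [v_i] by
    1. As long as an element of S is left, these drifts stay below the gap, so exactly the remaining
    elements of S reach equality. The sign collects one -1 for each of the [n - n_0] crossing pairs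
    met at each deletion of the first case. Both cases are instances of one elimination with three
    parameters: a cut-off [m] in the powers of q, the number [c] of crossing pairs per deletion, and
    the shift [e] of the exponents. The shift does not depend on which element of S is deleted, so
    all orderings end at the same constant term, which factors out. Partial fractions force the work
    into the fraction field, but their single terms become Laurent polynomials only after
    multiplication by the q-Dyson product; constant terms are split only then. *)

Lemma coef0_prod_one_sub (R : comNzRingType) (X : seq R) :
  (\prod_(x <- X) (1 - x *: 'X))`_0 = 1.
Proof.
rewrite -horner_coef0 horner_prod big1 // => x _.
by rewrite hornerD hornerN hornerZ hornerX hornerC mulr0 subr0.
Qed.

(** The product has constant coefficient 1, so the convolution equations determine the coefficients
    of [G] one after the other. Only degrees below [N] matter, which lets polynomials stand for
    power series. *)
Lemma complete_sym_unique (R : comNzRingType) (X : seq R) (N : nat) (G : {poly R}) :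
  (forall k, (k < N)%N -> (\prod_(x <- X) (1 - x *: 'X) * G)`_k = (k == 0%N)%:R) ->
  forall k, (k < N)%N -> G`_k = complete_sym X k.
Proof.
move=> HG; set P := (X in X * G) in HG *.
pose H := \poly_(k < N) complete_sym X k.
elim/ltn_ind => k IH kN.
have: (P * G)`_k = (P * H)`_k by rewrite HG // complete_sym_gen.
have HkE j : (j < N)%N -> H`_j = complete_sym X j by move=> jN; rewrite coef_poly jN.
rewrite !coefM !big_ord_recl /= coef0_prod_one_sub !mul1r subn0 HkE //.
rewrite (eq_bigr (fun i : 'I_k => P`_(bump 0 i) * H`_(k - bump 0 i))); first exact: addIr.
move=> i _; congr (_ * _).
have lt : (k - bump 0 i < k)%N by case: k i {IH kN} => [[] //|k] i; rewrite ltn_subrL.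
by rewrite IH ?HkE // (ltn_trans lt).
Qed.

Lemma complete_sym0 (R : comNzRingType) (X : seq R) : complete_sym X 0 = 1.
Proof.
rewrite -(@complete_sym_unique R X 1 1) ?coef1 // => k; rewrite ltnS leqn0 => /eqP ->.
by rewrite mulr1 coef0_prod_one_sub.
Qed.

Lemma complete_sym_nil (R : comNzRingType) r : complete_sym ([::] : seq R) r.+1 = 0.
Proof. by rewrite /complete_sym big_nil coef1. Qed.

(** Multiplying the generating series of [x :: X] by [1 - x z] leaves that of [X]. Later inductions
    on the alphabet and the degree run along this recursion. *)
Lemma complete_sym_cons (R : comNzRingType) (x : R) (X : seq R) r :
  complete_sym (x :: X) r.+1 = complete_sym X r.+1 + x * complete_sym (x :: X) r.
Proof.
pose H := \poly_(k < r.+2) complete_sym (x :: X) k.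
have E : ((1 - x *: 'X) * H)`_r.+1 = complete_sym X r.+1.
  apply: (@complete_sym_unique _ _ r.+2) => // k kr.
  by rewrite mulrA (mulrC (\prod_(_ <- _) _)) -(complete_sym_gen (x :: X) kr) big_cons.
rewrite -E mulrBl mul1r -scalerAl coefB coefZ coefXM /= !coef_poly ltnSn ltnS ltnW //.
by rewrite subrK.
Qed.

Lemma eq_complete_sym (R : comNzRingType) (X Y : seq R) r :
  perm_eq X Y -> complete_sym X r = complete_sym Y r.
Proof. by move=> XY; rewrite /complete_sym (perm_big _ XY). Qed.

(* The two sides of the polynomial identity agree at the points 1/f(j). *)
Lemma lagrange_one (K : fieldType) (I : eqType) (s : seq I) (f : I -> K) :
  s != [::] -> uniq s -> {in s &, injective f} -> (forall i, f i != 0) ->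
  \sum_(i <- s) (\prod_(j <- s | j != i) (1 - f j / f i))^-1 *:
     \prod_(j <- s | j != i) (1 - f j *: 'X) = 1.
Proof.
move=> s0 us finj f0; apply/eqP; rewrite -subr_eq0; set P := (X in X - 1).
apply/eqP; apply: (@roots_geq_poly_eq0 _ _ [seq (f i)^-1 | i <- s]).
- apply/allP => _ /mapP[i si ->]; rewrite /root hornerD hornerN hornerC subr_eq0.
  have hE j : (1 - f j *: 'X).[(f i)^-1] = 1 - f j / f i.
    by rewrite hornerD hornerN hornerZ hornerX hornerC.
  rewrite /P horner_sum (big_rem i) //= hornerZ horner_prod [X in _ + X]big1_seq.
    rewrite addr0 (eq_bigr _ (fun j _ => hE j)).
    rewrite mulVf // prodf_seq_neq0; apply/allP => j sj; apply/implyP => ji.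
    rewrite subr_eq0 eq_sym; apply: contraNneq ji => /(canRL (mulfVK (f0 i))).
    by rewrite mul1r => /(finj _ _ sj si) ->.
  move=> j /andP[_]; rewrite mem_rem_uniq // inE => /andP[ji sj].
  rewrite hornerZ horner_prod [X in _ * X](big_rem i) //= [i == j]eq_sym ji hE.
  by rewrite divff // subrr mul0r mulr0.
- by rewrite map_inj_in_uniq // => i j si sj /invr_inj; apply: finj.
(* Degree count: each summand has one linear factor fewer than [s] has elements, so the difference
   has size at most [size s], the number of its roots. *)
rewrite size_map; apply: leq_trans (size_polyD _ _) _.
rewrite size_polyN size_poly1 geq_max lt0n size_eq0 s0 andbT.
apply: leq_trans (size_sum _ _ _) _; apply/bigmax_leqP_seq => i si _.
apply: leq_trans (size_scale_leq _ _) _.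
rewrite -big_filter; set t := filter _ s.
have: (size t < size s)%N.
  rewrite size_filter -(count_predC (pred1 i) s) count_uniq_mem // si add1n ltnS.
  by apply/eq_leq/eq_count.
apply: leq_trans; elim: t => [|j t IH]; first by rewrite big_nil size_poly1.
rewrite big_cons (leq_trans (size_polyMleq _ _)) //= -subn1 leq_subLR.
rewrite (@leq_add _ _ 2 (size t).+1) // (leq_trans (size_polyD _ _)) //.
rewrite size_polyN size_poly1 geq_max /= (leq_trans (size_scale_leq _ _)) //.
by rewrite size_polyX.
Qed.

(** Dividing the identity of [lagrange_one] by the product of all [1 - f j z] turns its i-th term
    into a constant over [1 - f i z], a geometric series with coefficient [f i ^+ r] at [z^r]. *)
Lemma complete_sym_partial_fractions (K : fieldType) (I : eqType) (s : seq I)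
    (f : I -> K) r :
  s != [::] -> uniq s -> {in s &, injective f} -> (forall i, f i != 0) ->
  complete_sym [seq f i | i <- s] r
  = \sum_(i <- s) f i ^+ r / \prod_(j <- s | j != i) (1 - f j / f i).
Proof.
move=> s0 us finj f0; set c := fun i => (\prod_(j <- s | j != i) (1 - f j / f i))^-1.
pose G := \poly_(k < r.+1) \sum_(i <- s) f i ^+ k * c i.
suff H k : (k < r.+1)%N ->
    (\prod_(x <- [seq f i | i <- s]) (1 - x *: 'X) * G)`_k = (k == 0%N)%:R.
  by rewrite -(complete_sym_unique H (ltnSn r)) coef_poly ltnSn.
move=> kr; have GE : G = \sum_(i <- s) c i *: \poly_(k < r.+1) f i ^+ k.
  apply/polyP => j; rewrite coef_poly coef_sum; case: ltnP => jr.
    by apply: eq_bigr => i _; rewrite coefZ coef_poly jr mulrC.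
  by rewrite big1 // => i _; rewrite coefZ coef_poly ltnNge jr mulr0.
have := congr1 (fun p : {poly K} => p`_k) (lagrange_one s0 us finj f0).
rewrite /= coef1 => <-; rewrite GE mulr_sumr !coef_sum.
apply: eq_big_seq => i si; rewrite big_map -scalerAr !coefZ; congr (_ * _).
(* The factor [1 - f i z] is detached to meet the truncated geometric series; their product is 1 up
   to degree [r]. *)
rewrite [in LHS](bigD1_seq i) //= -mulrA mulrCA.
have kE j : (j <= r)%N -> ((1 - f i *: 'X) * \poly_(k < r.+1) f i ^+ k)`_j = (j == 0%N)%:R.
  move=> jr; rewrite mulrBl mul1r -scalerAl coefB coefZ coefXM !coef_poly ltnS jr.
  case: j jr => [|j] jr /=; first by rewrite mulr0 subr0.
  by rewrite (ltn_trans jr) // exprS subrr.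
rewrite coefM (bigD1 ord_max) //= subnn kE // mulr1 [X in _ + X]big1 ?addr0 // => j.
rewrite -val_eqE /= => jk; rewrite kE; last by rewrite (leq_trans (leq_subr _ _)).
by rewrite subn_eq0 leqNgt ltn_neqAle jk -ltnS ltn_ord mulr0.
Qed.

(** * q-shifted factorials and q-binomial coefficients *)

Lemma qpochD (R : pzRingType) (q z : R) m k :
  qpoch q z (m + k) = qpoch q z m * qpoch q (z * q ^+ m) k.
Proof.
rewrite /qpoch big_split_ord /=; congr (_ * _).
by apply: eq_bigr => i _; rewrite exprD mulrA.
Qed.

Lemma qpochS (R : pzRingType) (q z : R) k :
  qpoch q z k.+1 = qpoch q z k * (1 - z * q ^+ k).
Proof. by rewrite /qpoch big_ord_recr. Qed.

Lemma qpoch0 (R : pzRingType) (q z : R) : qpoch q z 0 = 1.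
Proof. by rewrite /qpoch big_ord0. Qed.

(** Each factor is inverted, [1 - z q^i = - z q^i (1 - z^-1 q^-i)], and the order is reversed. This
    turns factors in [x_l / x_i] into factors in [x_i / x_l], which can be evaluated at
    [x_i = 0]. *)
Lemma qpoch_rev (K : fieldType) (q z : K) k : q != 0 -> z != 0 ->
  qpoch q z k = (- z) ^+ k * \prod_(i < k) q ^+ i * qpoch q (z^-1 * q / q ^+ k) k.
Proof.
move=> q0 z0; rewrite -[in (- z) ^+ k](card_ord k) -prodr_const /qpoch.
rewrite [X in _ * X](reindex_inj rev_ord_inj) -!big_split /=.
apply: eq_bigr => i _.
have -> : z^-1 * q / q ^+ k * q ^+ (k - i.+1) = (z * q ^+ i)^-1.
  have -> : q ^+ k = q ^+ (k - i.+1) * (q * q ^+ i) by rewrite -exprS -exprD subnK.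
  by field; rewrite !expf_neq0 ?q0 ?z0.
by field; rewrite expf_neq0 ?z0.
Qed.

Section QBinomial.
Variables (F : fieldType) (q : F).
Hypothesis q_order : forall k : nat, (0 < k)%N -> q ^+ k != 1.

Lemma qpoch_neq0 k : qpoch q q k != 0.
Proof. by apply/prodf_neq0 => i _; rewrite -exprS subr_eq0 eq_sym q_order. Qed.

(** The right side is the q-binomial coefficient of [m + b] over [m + 1]. Writing
    [(1 - q^b) / (q)_b] for [1 / (q)_(b-1)] covers [b = 0], which occurs when [a_i = 1] and
    [i <= n_0]. *)
Lemma complete_sym_qpowers b m :
  complete_sym [seq q ^+ k | k <- iota 0 b] m.+1
  = (1 - q ^+ b) * qpoch q q (m + b) / (qpoch q q b * qpoch q q m.+1).
Proof.
have S b' m' : complete_sym [seq q ^+ k | k <- iota 0 b'.+1] m'.+1 =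
    complete_sym [seq q ^+ k | k <- iota 0 b'] m'.+1
    + q ^+ b' * complete_sym [seq q ^+ k | k <- iota 0 b'.+1] m'.
  have P : perm_eq [seq q ^+ k | k <- iota 0 b'.+1]
                   (q ^+ b' :: [seq q ^+ k | k <- iota 0 b']).
    by rewrite -addn1 iotaD map_cat add0n perm_catC.
  by rewrite !(eq_complete_sym _ P) complete_sym_cons.
have D k : 1 - q * q ^+ k != 0 by rewrite -exprS subr_eq0 eq_sym q_order.
elim: b m => [|b IH] m; first by rewrite complete_sym_nil expr0 subrr !mul0r.
elim: m => [|m IHm]; rewrite S IH.
  rewrite complete_sym0 !add0n !qpochS qpoch0 !exprS expr0 !mulr1 !mul1r.
  have := (qpoch_neq0 b, D b, D 0%N); rewrite expr0 mulr1 => -[[? ?] ?].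
  by field; do ?[apply/andP; split].
rewrite IHm !addnS !addSn !qpochS !exprS !exprD.
have := (qpoch_neq0 b, qpoch_neq0 m, D b, D m, D m.+1); rewrite !exprS => -[[[[? ?] ?] ?] ?].
by field; do ?[apply/andP; split].
Qed.

End QBinomial.

(** * Laurent polynomials and constant terms *)

Lemma mulr_congruence (R : comNzRingType) (a b c d x : R) :
  (a + x * b) * (c + x * d) = a * c + x * (a * d + b * c + x * b * d).
Proof. by ring. Qed.

Section Laurent.
Variables (F : fieldType) (n : nat).
Local Notation K := {fraction {mpoly F[n]}}.
Implicit Types (f g : K) (D : {set 'I_n}) (i j : 'I_n).

Lemma tofracX_neq0 (m : 'X_{1..n}) : tofrac 'X_[m] != 0 :> K.
Proof.
rewrite tofrac_eq0; apply/eqP => /(congr1 (mcoeff m)) /eqP.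
by rewrite mcoeffX eqxx mcoeff0 oner_eq0.
Qed.

Lemma fvar_neq0 i : fvar F i != 0.
Proof. exact: tofracX_neq0. Qed.

Lemma fconstM (c d : F) : fconst n (c * d) = fconst n c * fconst n d.
Proof. by rewrite /fconst !rmorphM. Qed.

Lemma fconst1 : fconst n (1 : F) = 1.
Proof. by rewrite /fconst !rmorph1. Qed.

Lemma fconstB (c d : F) : fconst n (c - d) = fconst n c - fconst n d.
Proof. by rewrite /fconst !rmorphB. Qed.

Lemma fconstX (c : F) k : fconst n (c ^+ k) = fconst n c ^+ k.
Proof. by rewrite /fconst !rmorphXn. Qed.

Lemma fconstV (c : F) : fconst n c^-1 = (fconst n c)^-1.
Proof. exact: (fmorphV (@tofrac _ \o @mpolyC n F)). Qed.

Lemma fconst_prod (I : Type) (s : seq I) (P : pred I) (c : I -> F) :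
  fconst n (\prod_(i <- s | P i) c i) = \prod_(i <- s | P i) fconst n (c i).
Proof. by rewrite /fconst !rmorph_prod. Qed.

Lemma fconst_eq0 (c : F) : (fconst n c == 0) = (c == 0).
Proof. by rewrite /fconst tofrac_eq0 mpolyC_eq0. Qed.

Lemma fvar_const_inj (c d : F) i j : c != 0 ->
  fvar F i * fconst n c = fvar F j * fconst n d -> i = j /\ c = d.
Proof.
move=> c0 /eqP; rewrite -!rmorphM tofrac_eq => /eqP /(congr1 (mcoeff U_(i))).
rewrite ![_ * _%:MP]mulrC !mcoeffCM !mcoeffXU eqxx mulr1.
case: eqVneq => [->|_]; first by rewrite mulr1.
by rewrite mulr0 => c0'; rewrite c0' eqxx in c0.
Qed.

(* Laurent polynomials in which only the variables in D occur with negative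
   exponents. *)
Definition laurent D f : Prop :=
  exists p (m : 'X_{1..n}), (forall i, i \notin D -> m i = 0%N) /\
    f = tofrac p / tofrac 'X_[m].

Lemma laurent_sub D D' f : D \subset D' -> laurent D f -> laurent D' f.
Proof.
move=> sD [p [m [Hm ->]]]; exists p, m; split=> // i iD'; apply: Hm.
by apply: contra iD'; apply/subsetP.
Qed.

Lemma laurent_tofrac D p : laurent D (tofrac p).
Proof.
exists p, 0%MM; split=> [i _|]; first by rewrite mnm0E.
by rewrite mpolyX0 rmorph1 divr1.
Qed.

Lemma laurent_const D c : laurent D (fconst n c).
Proof. exact: laurent_tofrac. Qed.

Lemma laurent1 D : laurent D 1.
Proof. by rewrite -fconst1; apply: laurent_const. Qed.

Lemma laurent0 D : laurent D 0.
Proof. by rewrite -(rmorph0 (@tofrac _)); apply: laurent_tofrac. Qed.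

Lemma laurent_var D i : laurent D (fvar F i).
Proof. exact: laurent_tofrac. Qed.

Lemma laurentM D f g : laurent D f -> laurent D g -> laurent D (f * g).
Proof.
move=> [p [m [Hm ->]]] [p' [m' [Hm' ->]]]; exists (p * p'), (m + m')%MM; split.
  by move=> i iD; rewrite mnmDE Hm ?Hm'.
by rewrite mpolyXD !rmorphM invfM mulrACA.
Qed.

Lemma laurentD D f g : laurent D f -> laurent D g -> laurent D (f + g).
Proof.
move=> [p [m [Hm ->]]] [p' [m' [Hm' ->]]].
exists (p * 'X_[m'] + p' * 'X_[m]), (m + m')%MM; split.
  by move=> i iD; rewrite mnmDE Hm ?Hm'.
by rewrite mpolyXD rmorphD !rmorphM addf_div ?tofracX_neq0.
Qed.

Lemma laurentN D f : laurent D f -> laurent D (- f).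
Proof.
move=> Hf; rewrite -mulN1r -fconst1 /fconst -!rmorphN.
exact/laurentM/Hf/laurent_tofrac.
Qed.

Lemma laurentB D f g : laurent D f -> laurent D g -> laurent D (f - g).
Proof. by move=> Hf Hg; apply: laurentD => //; apply: laurentN. Qed.

Lemma laurentX D f k : laurent D f -> laurent D (f ^+ k).
Proof.
move=> Hf; elim: k => [|k IH]; first exact: laurent1.
by rewrite exprS; apply: laurentM.
Qed.

Lemma laurent_varV D i : i \in D -> laurent D (fvar F i)^-1.
Proof.
move=> iD; exists 1, U_(i)%MM; split; last by rewrite rmorph1 mul1r.
by move=> j; rewrite mnm1E; case: eqVneq => [<-|//]; rewrite iD.
Qed.

Lemma laurent_varZ D i (z : int) : i \in D -> laurent D (fvar F i ^ z).
Proof.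
move=> iD; case: z => k; first exact/laurentX/laurent_var.
by rewrite NegzE -exprz_inv; apply/laurentX/laurent_varV.
Qed.

Lemma laurent_prod (I : eqType) (s : seq I) (P : pred I) (h : I -> K) D :
  (forall x, x \in s -> P x -> laurent D (h x)) ->
  laurent D (\prod_(x <- s | P x) h x).
Proof.
move=> Hh; rewrite big_seq_cond; apply: (big_ind (laurent D)).
- exact: laurent1.
- exact: laurentM.
- by move=> x /andP[]; apply: Hh.
Qed.

Lemma laurent_qpoch D c f k : laurent D c -> laurent D f -> laurent D (qpoch c f k).
Proof.
by move=> Hc Hf; apply: laurent_prod => i _ _;
   apply/(laurentB (laurent1 _))/laurentM/laurentX.
Qed.

Lemma laurent_complete_sym D X r :
  (forall x, x \in X -> laurent D x) -> laurent D (complete_sym X r).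
Proof.
elim: X r => [|x X IH] r HX.
  by case: r => [|r]; rewrite ?complete_sym0 ?complete_sym_nil;
     [apply: laurent1 | apply: laurent0].
elim: r => [|r IHr]; first by rewrite complete_sym0; apply: laurent1.
rewrite complete_sym_cons; apply: laurentD.
  by apply: IH => y yX; apply: HX; rewrite inE yX orbT.
by apply: laurentM => //; apply: HX; rewrite mem_head.
Qed.

Lemma CTD D f g : laurent D f -> laurent D g -> CT (f + g) = CT f + CT g.
Proof.
move=> [p [m [_ ->]]] [p' [m' [_ ->]]].
rewrite addf_div ?tofracX_neq0 // -!rmorphM -rmorphD -mpolyXD.
by rewrite !CT_laurent mcoeffD [X in _ + X]mcoeffMX addmC mcoeffMX.
Qed.

Lemma CT0 : CT (0 : K) = 0.
Proof.
have -> : (0 : K) = tofrac 0 / tofrac 'X_[0%MM] by rewrite rmorph0 mul0r.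
by rewrite CT_laurent mcoeff0.
Qed.

Lemma CT_sum D (I : eqType) (s : seq I) (h : I -> K) :
  (forall x, x \in s -> laurent D (h x)) ->
  CT (\sum_(x <- s) h x) = \sum_(x <- s) CT (h x).
Proof.
elim: s => [|x s IH] Hh; first by rewrite !big_nil CT0.
have Hs y : y \in s -> laurent D (h y) by move=> ys; apply: Hh; rewrite inE ys orbT.
rewrite !big_cons (@CTD D) ?IH //; first by apply: Hh; rewrite mem_head.
rewrite big_seq; apply: (big_ind (laurent D)) => //; first exact: laurent0.
exact: laurentD.
Qed.

Lemma CT_constM D c f : laurent D f -> CT (fconst n c * f) = c * CT f.
Proof.
move=> [p [m [_ ->]]]; rewrite mulrA -rmorphM !CT_laurent.
by rewrite mcoeffCM.
Qed.

(** No negative power of [x_i] occurs in [f], so every monomial of the product contains a positive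
    one. *)
Lemma CT_varM i f : laurent [set~ i] f -> CT (fvar F i * f) = 0.
Proof.
move=> [p [m [Hm ->]]]; rewrite mulrA -rmorphM CT_laurent mulrC.
rewrite mcoeffM big1 // => -[k1 k2] /= /eqP mE; rewrite mcoeffX.
case: eqVneq => [Uk|]; last by rewrite mulr0.
have := congr1 (fun m' : 'X_{1..n} => m' i) mE.
by rewrite /= mnmDE -Uk mnm1E eqxx addn1 Hm // !inE eqxx.
Qed.

(* f = g modulo x_i, in the ring of Laurent polynomials without negative powers
   of x_i. *)
Definition eqvar i f g : Prop :=
  laurent [set~ i] g /\ exists2 h, laurent [set~ i] h & f = g + fvar F i * h.

Lemma eqvar_laurent i f g : eqvar i f g -> laurent [set~ i] f.
Proof.
move=> [Hg [h Hh ->]]; apply: laurentD => //.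
by apply: laurentM => //; apply: laurent_var.
Qed.

Lemma eqvar_CT i f g : eqvar i f g -> CT f = CT g.
Proof.
move=> [Hg [h Hh ->]]; rewrite (CTD Hg); first by rewrite CT_varM ?addr0.
by apply: laurentM => //; apply: laurent_var.
Qed.

Lemma eqvar_refl i f : laurent [set~ i] f -> eqvar i f f.
Proof. by split=> //; exists 0; [exact: laurent0 | rewrite mulr0 addr0]. Qed.

Lemma eqvarD i f g f' g' : eqvar i f g -> eqvar i f' g' -> eqvar i (f + f') (g + g').
Proof.
move=> [Hg [h Hh ->]] [Hg' [h' Hh' ->]]; split; first exact: laurentD.
by exists (h + h'); [exact: laurentD | rewrite mulrDr addrACA].
Qed.

Lemma eqvarM i f g f' g' : eqvar i f g -> eqvar i f' g' -> eqvar i (f * f') (g * g').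
Proof.
move=> [Hg [h Hh ->]] [Hg' [h' Hh' ->]]; split; first exact: laurentM.
exists (g * h' + h * g' + fvar F i * h * h').
  by repeat first [apply: laurentD | apply: laurentM] => //; apply: laurent_var.
exact: mulr_congruence.
Qed.

Lemma eqvar_prod i (I : eqType) (s : seq I) (P : pred I) (f g : I -> K) :
  (forall x, x \in s -> P x -> eqvar i (f x) (g x)) ->
  eqvar i (\prod_(x <- s | P x) f x) (\prod_(x <- s | P x) g x).
Proof.
move=> H; rewrite big_seq_cond [X in eqvar _ _ X]big_seq_cond.
apply: (big_ind2 (eqvar i)).
- exact/eqvar_refl/laurent1.
- by move=> *; apply: eqvarM.
- by move=> j /andP[]; apply: H.
Qed.

Lemma eqvar_qpoch1 i h k c : laurent [set~ i] c -> laurent [set~ i] h ->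
  eqvar i (qpoch c (fvar F i * h) k) 1.
Proof.
move=> Hc Hh; have -> : 1 = \prod_(j < k) (1 : K) by rewrite big1.
apply: eqvar_prod => j _ _; split; first exact: laurent1.
exists (- (h * c ^+ j)); last by rewrite mulrN mulrA.
exact/laurentN/laurentM/laurentX.
Qed.

(** Letters divisible by [x_i] vanish at [x_i = 0]; in [complete_sym_cons] the second summand is
    then divisible by [x_i]. *)
Lemma eqvar_complete_sym i X Y r :
  (forall x, x \in X -> laurent [set~ i] x) ->
  (forall y, y \in Y -> exists2 h, laurent [set~ i] h & y = fvar F i * h) ->
  eqvar i (complete_sym (Y ++ X) r) (complete_sym X r).
Proof.
move=> HX; elim: Y r => [|y Y IH] r HY; first exact/eqvar_refl/laurent_complete_sym.
have IH' r' := IH r' (fun z zY => HY z (@mem_behead _ (y :: Y) z zY)).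
elim: r => [|r IHr] /=; first by rewrite !complete_sym0; apply/eqvar_refl/laurent1.
rewrite complete_sym_cons -[X in eqvar _ _ X]addr0; apply: eqvarD => //.
have [h Hh ->] := HY y (mem_head _ _); split; first exact: laurent0.
exists (h * complete_sym (fvar F i * h :: Y ++ X) r); last by rewrite add0r mulrA.
apply: laurentM => //; apply: laurent_complete_sym => z.
rewrite inE mem_cat => /orP[/eqP ->|/orP[zY|/HX //]].
  by apply: laurentM => //; exact: laurent_var.
have [h' Hh' ->] := HY z (@mem_behead _ (y :: Y) z zY).
by apply: laurentM => //; exact: laurent_var.
Qed.

End Laurent.

Lemma eqvar_complete_sym_part (F : fieldType) n (i : 'I_n) X Y la :
  (forall x, x \in X -> @laurent F n [set~ i] x) ->
  (forall y, y \in Y -> exists2 h, laurent [set~ i] h & y = fvar F i * h) ->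
  eqvar i (complete_sym_part (Y ++ X) la) (complete_sym_part X la).
Proof. by move=> HX HY; apply: eqvar_prod => l _ _; apply: eqvar_complete_sym. Qed.

(** * Renaming variables along an injection of the indices *)

Section Relabel.
Variables (F : fieldType) (n' n : nat) (s : 'I_n' -> 'I_n).
Hypothesis s_inj : injective s.
Local Notation K' := {fraction {mpoly F[n']}}.
Local Notation K := {fraction {mpoly F[n]}}.

Local Notation relabel := (comp_mpoly [tuple 'X_(s j) | j < n'] : {mpoly F[n']} -> {mpoly F[n]}).

Definition relabel_mnm (m : 'X_{1..n'}) : 'X_{1..n} :=
  (\sum_(j < n') U_(s j) *+ m j)%MM.

Lemma relabelX m : relabel 'X_[m] = 'X_[relabel_mnm m].
Proof.
rewrite comp_mpolyX /relabel_mnm -mprodXE.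
by apply: eq_bigr => j _; rewrite tnth_mktuple mpolyXn.
Qed.

Lemma relabel_mnmE m j : relabel_mnm m (s j) = m j.
Proof.
rewrite /relabel_mnm mnm_sumE (bigD1 j) //= mulmnE mnm1E eqxx mul1n big1 ?addn0 // => k kj.
by rewrite mulmnE mnm1E (inj_eq s_inj) (negPf kj).
Qed.

Lemma relabel_mnm_inj : injective relabel_mnm.
Proof. by move=> m m' e; apply/mnmP => j; rewrite -!relabel_mnmE e. Qed.

Lemma relabel_mnmD m m' : relabel_mnm (m + m') = (relabel_mnm m + relabel_mnm m')%MM.
Proof.
apply/mnmP => i; rewrite mnmDE !mnm_sumE -big_split; apply: eq_bigr => j _ /=.
by rewrite !mulmnE mnmDE mulnDr.
Qed.

Lemma mcoeff_relabel p m : (relabel p)@_(relabel_mnm m) = p@_m.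
Proof.
rewrite [in RHS](mpolyE p) comp_mpolyEX !raddf_sum; apply: eq_bigr => m' _ /=.
by rewrite !mcoeffZ relabelX !mcoeffX (inj_eq relabel_mnm_inj).
Qed.

(** A relation on quotients by monomials spares extending the renaming of polynomials to a map of
    fraction fields. It is needed because D of the shortened sequences lives in fewer variables,
    whereas the elimination never leaves the ring in [n] variables. *)
Definition relabelled (f : K') (g : K) : Prop :=
  exists p (m : 'X_{1..n'}), f = tofrac p / tofrac 'X_[m] /\
    g = tofrac (relabel p) / tofrac 'X_[relabel_mnm m].

Lemma relabelled_CT f g : relabelled f g -> CT f = CT g.
Proof. by move=> [p [m [-> ->]]]; rewrite !CT_laurent mcoeff_relabel. Qed.

Lemma relabelled_tofrac p : relabelled (tofrac p) (tofrac (relabel p)).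
Proof.
exists p, 0%MM; rewrite -relabelX mpolyX0 !rmorph1 !divr1 //.
Qed.

Lemma relabelled_const c : relabelled (fconst n' c) (fconst n c).
Proof. by rewrite /fconst -(comp_mpolyC c [tuple 'X_(s j) | j < n']); apply: relabelled_tofrac. Qed.

Lemma relabelled1 : relabelled 1 1.
Proof. by rewrite -!fconst1; apply: relabelled_const. Qed.

Lemma relabelled0 : relabelled 0 0.
Proof. by have := relabelled_const 0; rewrite /fconst !rmorph0. Qed.

Lemma relabelled_var j : relabelled (fvar F j) (fvar F (s j)).
Proof.
have := relabelled_tofrac 'X_j; rewrite comp_mpolyXU -tnth_nth tnth_mktuple.
exact.
Qed.

Lemma relabelledM f g f' g' :
  relabelled f g -> relabelled f' g' -> relabelled (f * f') (g * g').
Proof.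
move=> [p [m [-> ->]]] [p' [m' [-> ->]]]; exists (p * p'), (m + m')%MM.
by rewrite relabel_mnmD !mpolyXD !rmorphM !invfM; split; exact: mulrACA.
Qed.

Lemma relabelledD f g f' g' :
  relabelled f g -> relabelled f' g' -> relabelled (f + f') (g + g').
Proof.
move=> [p [m [-> ->]]] [p' [m' [-> ->]]].
exists (p * 'X_[m'] + p' * 'X_[m]), (m + m')%MM.
rewrite relabel_mnmD !addf_div ?tofracX_neq0 //.
by rewrite !mpolyXD !rmorphD !rmorphM /= !relabelX.
Qed.

Lemma relabelledN f g : relabelled f g -> relabelled (- f) (- g).
Proof.
by move=> [p [m [-> ->]]]; exists (- p), m; rewrite !rmorphN /= !mulNr.
Qed.

Lemma relabelledX f g k : relabelled f g -> relabelled (f ^+ k) (g ^+ k).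
Proof.
move=> H; elim: k => [|k IH]; first exact: relabelled1.
by rewrite !exprS; apply: relabelledM.
Qed.

Lemma relabelled_varV j : relabelled (fvar F j)^-1 (fvar F (s j))^-1.
Proof.
exists 1, U_(j)%MM; rewrite -relabelX -[relabel 'X_j]/(relabel 'X_j).
by rewrite comp_mpolyXU -tnth_nth tnth_mktuple !rmorph1 !mul1r.
Qed.

Lemma relabelled_varZ j (z : int) : relabelled (fvar F j ^ z) (fvar F (s j) ^ z).
Proof.
case: z => k; first exact/relabelledX/relabelled_var.
by rewrite NegzE -!exprz_inv; apply/relabelledX/relabelled_varV.
Qed.

Lemma relabelled_prod (I : eqType) (t : seq I) (P : pred I) (f : I -> K') (g : I -> K) :
  (forall x, x \in t -> P x -> relabelled (f x) (g x)) ->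
  relabelled (\prod_(x <- t | P x) f x) (\prod_(x <- t | P x) g x).
Proof.
move=> H; rewrite big_seq_cond [X in relabelled _ X]big_seq_cond.
apply: (big_ind2 relabelled); [exact: relabelled1|by move=> *; apply: relabelledM|].
by move=> j /andP[]; apply: H.
Qed.

Lemma relabelled_qpoch c d f g k : relabelled c d -> relabelled f g ->
  relabelled (qpoch c f k) (qpoch d g k).
Proof.
move=> Hc Hf; apply: relabelled_prod => i _ _; apply: relabelledD; first exact: relabelled1.
by apply/relabelledN/relabelledM => //; apply: relabelledX.
Qed.

Lemma relabelled_complete_sym (I : eqType) (t : seq I) (f : I -> K') (g : I -> K) r :
  (forall x, x \in t -> relabelled (f x) (g x)) ->
  relabelled (complete_sym (map f t) r) (complete_sym (map g t) r).
Proof.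
elim: t r => [|x t IH] r H.
  by case: r => [|r]; rewrite ?complete_sym0 ?complete_sym_nil;
     [apply: relabelled1 | apply: relabelled0].
elim: r => [|r IHr]; first by rewrite !complete_sym0; apply: relabelled1.
rewrite /= !complete_sym_cons; apply: relabelledD.
  by apply: IH => y yt; apply: H; rewrite inE yt orbT.
by apply: relabelledM => //; apply: H; rewrite mem_head.
Qed.

End Relabel.

(** * The sum over subsets *)

Section SubsetSum.
Variables (F : fieldType) (q : F) (n : nat) (b : 'I_n -> nat) (m r : nat).
Hypothesis q_order : forall k : nat, (0 < k)%N -> q ^+ k != 1.
Hypothesis r_gt0 : (0 < r)%N.
Implicit Types (A S J T : {set 'I_n}) (i j : 'I_n).

Definition wt A := (\sum_(i in A) b i)%N.
(** The exponent L of the theorem with [j] confined to a set [A] of surviving indices, which shrinks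
    along the recursion. *)
Definition Lexp A S J := (\sum_(i in S) \sum_(j in A | [&& (i <= j)%N, (j < m)%N & j \notin J]) b j)%N.
Definition after A i := (\sum_(j in A | (i < j < m)%N) b j)%N.

Definition jsum A S : F :=
  \sum_(J : {set 'I_n} | (J != set0) && (J \subset S))
    (-1) ^+ #|S :\: J| * q ^+ Lexp A S J * ((1 - q ^+ wt J) / (1 - q ^+ (wt A - wt J + r))).

Lemma wtD1 A i : i \in A -> wt A = (b i + wt (A :\ i))%N.
Proof. by move=> iA; rewrite /wt (big_setD1 i). Qed.

Lemma wt_sub A J : J \subset A -> (wt J <= wt A)%N.
Proof. by move=> JA; rewrite /wt [leqRHS](big_setID J) /= (setIidPr JA) leq_addr. Qed.

(* Telescoping sum along the elements of J in decreasing order. *)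
Lemma telescope_subset J : {in J, forall i, (i < m)%N} ->
  \sum_(i in J) q ^+ after J i * (1 - q ^+ b i) = 1 - q ^+ wt J.
Proof.
move: {2}#|J| (erefl #|J|) => k; elim: k J => [|k IH] J cJ Jm.
  by move/eqP: cJ; rewrite cards_eq0 => /eqP ->; rewrite /wt !big_set0 subrr.
have [i0 i0J] : exists i0, i0 \in J by apply/set0Pn; rewrite -cards_eq0 cJ.
case: (@arg_minnP _ i0 (fun i => i \in J) (@nat_of_ord n) i0J) => i iJ imin {i0 i0J}.
rewrite (big_setD1 i) //= (wtD1 iJ).
have -> : after J i = wt (J :\ i).
  apply: eq_bigl => j; rewrite !inE; have [jJ|] := boolP (j \in J); last by rewrite andbF.
  by rewrite (Jm _ jJ) !andbT ltn_neqAle imin // andbT eq_sym.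
have -> : \sum_(j in J :\ i) q ^+ after J j * (1 - q ^+ b j) = 1 - q ^+ wt (J :\ i).
  rewrite -IH; last by move=> j; rewrite !inE => /andP[_ /Jm].
    apply: eq_bigr => j; rewrite !inE => /andP[ji jJ]; congr (q ^+ _ * _).
    apply: eq_bigl => l; rewrite !inE; case: eqP => [->|//] /=.
    by rewrite ltnNge imin // andbF.
  by move: cJ; rewrite (cardsD1 i) iJ add1n => -[].
by rewrite exprD; ring.
Qed.

Lemma Lexp_exchange A S J :
  Lexp A S J = (\sum_(j in A | (j < m)%N && (j \notin J)) \sum_(i in S | (i <= j)%N) b j)%N.
Proof.
rewrite /Lexp (exchange_big_dep (fun j => [&& j \in A, (j < m)%N & j \notin J])) /=.
  apply: eq_bigr => j /and3P[jA jm jJ]; apply: eq_bigl => i.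
  by rewrite jA jm jJ !andbT.
by move=> i j _ /and4P[-> _ -> ->].
Qed.

(* Toggling the smallest element of T reverses the sign of the summand. *)
Lemma toggle_sum A T : T \subset A -> {in T, forall i, (i < m)%N} ->
  \sum_(J : {set 'I_n} | J \subset T) (-1) ^+ #|T :\: J| * q ^+ (wt J + Lexp A T J)
  = (T == set0)%:R.
Proof.
move=> TA Tm; have [->|/set0Pn[i0 i0T]] := eqVneq T set0.
  rewrite (big_pred1 set0); last by move=> J; rewrite subset0.
  by rewrite set0D cards0 /wt /Lexp !big_set0 mulr1.
case: (@arg_minnP _ i0 (fun i => i \in T) (@nat_of_ord n) i0T) => t tT tmin {i0 i0T}.
rewrite (bigID (fun J : {set 'I_n} => t \in J)) /=.
rewrite (reindex_onto (fun J => t |: J) (fun J => J :\ t)) /=; last first.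
  by move=> J /andP[_ tJ]; rewrite setD1K.
rewrite (eq_bigl (fun J : {set 'I_n} => (J \subset T) && (t \notin J))); last first.
  move=> J; rewrite setU11 andbT subUset sub1set tT /=; congr (_ && _).
  apply/eqP/idP => [<-|tJ]; first by rewrite !inE eqxx.
  by rewrite setU1K.
rewrite -big_split big1 //= => J /andP[JT tJ].
have -> : #|T :\: J| = #|T :\: (t |: J)|.+1.
  rewrite (cardsD1 t (T :\: J)) !inE tT tJ add1n; congr _.+1; apply: eq_card => j.
  by rewrite !inE negb_or -andbA.
have -> : wt (t |: J) = (b t + wt J)%N by rewrite /wt big_setU1.
(* By minimality, [t] is the only index of [T] that is at most [t]. Moving [t] into [J] thus removes
   exactly [b t] from [Lexp], the amount gained by [wt], and only the sign changes. *)
have -> : Lexp A T J = (b t + Lexp A T (t |: J))%N.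
  rewrite !Lexp_exchange (bigD1 t) /=; last by rewrite (subsetP TA) ?tT ?Tm ?tJ.
  rewrite (big_pred1 t); last first.
    move=> i /=; apply/andP/eqP => [[iT it]|->]; last by rewrite tT leqnn.
    by apply/val_inj/eqP; rewrite eqn_leq it tmin.
  congr (_ + _)%N; apply: eq_bigl => j; rewrite !inE negb_or -!andbA.
  by rewrite [(j != t)]/negb; case: (j == t); rewrite ?andbF ?andbT.
by rewrite addnCA addnA exprS; ring.
Qed.

(** Row [i] of [Lexp A S J] collects the indices outside [J]; joined with [after J i] it gives
    [after A i]. The other rows never meet column [i], because [i] lies in [J]. *)
Lemma after_Lexp A S J i : i \in J -> J \subset S -> S \subset A ->
  (after A i + Lexp (A :\ i) (S :\ i) (J :\ i) = after J i + Lexp A S J)%N.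
Proof.
move=> iJ JS SA; have iS := subsetP JS i iJ.
rewrite {2}/Lexp (big_setD1 i) //= addnA; congr (_ + _)%N.
  rewrite /after (bigID (fun j => j \in J)) /=; congr (_ + _)%N; apply: eq_bigl => j.
    have [jJ|] := boolP (j \in J); last by rewrite andbF.
    by rewrite (subsetP SA) ?(subsetP JS) ?jJ // andbT.
  rewrite -!andbA; congr (_ && _); rewrite [(i <= j)%N]leq_eqVlt (inj_eq val_inj).
  by case: eqP => [<-|] //=; rewrite iJ /= !andbF.
apply: eq_bigr => k _; apply: eq_bigl => j; rewrite !inE.
by case: eqP => [->|] //=; rewrite iJ !andbF.
Qed.

(* On S = set0, the sum over the orderings of S is 1, whereas jsum is 0. *)
Definition jsum1 A S : F := if S == set0 then 1 else jsum A S.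

(** Here [i] is the element deleted first; unfolding down to [jsum1] of the empty set gives the sum
    over the orderings of [S]. *)
Lemma jsum_rec A S : S \subset A -> {in S, forall i, (i < m)%N} -> S != set0 ->
  jsum A S = \sum_(i in S) q ^+ after A i * (1 - q ^+ b i) / (1 - q ^+ (wt A - b i + r))
                * jsum1 (A :\ i) (S :\ i).
Proof.
move=> SA Sm S0; pose Z J : F := (1 - q ^+ (wt A - wt J + r))^-1.
have D k : 1 - q ^+ (k + r) != 0.
  by rewrite subr_eq0 eq_sym q_order // addn_gt0 r_gt0 orbT.
pose f i J := (-1) ^+ #|S :\: J| * Z J * q ^+ Lexp A S J * (q ^+ after J i * (1 - q ^+ b i)).
have step i : i \in S ->
  q ^+ after A i * (1 - q ^+ b i) / (1 - q ^+ (wt A - b i + r)) * jsum1 (A :\ i) (S :\ i)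
  = \sum_(J : {set 'I_n} | (J \subset S) && (i \in J)) f i J.
  move=> iS; have iA := subsetP SA i iS; set T := S :\ i; set A' := A :\ i.
  have TA : T \subset A' by apply: setSD.
  have Tm : {in T, forall j, (j < m)%N} by move=> j; rewrite !inE => /andP[_ /Sm].
  have wA : wt A = (b i + wt A')%N by apply: wtD1.
  pose g J := (-1) ^+ #|T :\: J| * q ^+ Lexp A' T J * (1 - q ^+ (wt A' - wt J + r))^-1.
  have E : (1 - q ^+ (wt A - b i + r))^-1 * jsum1 A' T = \sum_(J : {set 'I_n} | J \subset T) g J.
    rewrite wA addKn.
    have -> : jsum1 A' T = (T == set0)%:R + jsum A' T.
      rewrite /jsum1; case: eqP => [->|]; last by rewrite add0r.
      rewrite /jsum big1 ?addr0 // => J.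
      by rewrite subset0 andNb.
    (* Trading the indicator for the signed sum puts [q^(wt J)] beside [(1 - q^(wt J)) / (1 - q^(wt
       A' - wt J + r))] for each nonempty [J]. Over the common denominator they add up to
       [1 - q^(wt A' + r)], which cancels the factor in front. *)
    rewrite -(toggle_sum TA Tm) [in LHS](bigD1 set0) ?sub0set //=.
    rewrite [in RHS](bigD1 set0) ?sub0set //=.
    have -> : jsum A' T = \sum_(J : {set 'I_n} | (J \subset T) && (J != set0))
        (-1) ^+ #|T :\: J| * q ^+ Lexp A' T J * ((1 - q ^+ wt J) / (1 - q ^+ (wt A' - wt J + r))).
      by apply: eq_bigl => J; rewrite andbC.
    rewrite -addrA -big_split /= mulrDr mulr_sumr; congr (_ + _).
      by rewrite /g /wt big_set0 subn0 mulrC add0n.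
    apply: eq_bigr => J /andP[JT _].
    have wJ : (wt J <= wt A')%N by apply/wt_sub/(subset_trans JT).
    have -> : (wt A' + r = wt J + (wt A' - wt J + r))%N by rewrite addnA subnKC.
    have := (D (wt J + (wt A' - wt J))%N, D (wt A' - wt J)%N); rewrite -addnA /g.
    rewrite !exprD => -[D1 D2].
    by field; apply/andP; split.
  rewrite -mulrA E mulr_sumr.
  (* Adding [i] to [J] matches the subsets of [T] with the subsets of [S] containing [i]. Since
     [wt A' - wt J = wt A - wt (i |: J)], the denominator no longer depends on [i]. *)
  rewrite [RHS](reindex_onto (fun J => i |: J) (fun J => J :\ i)) /=; last first.
    by move=> J /andP[_ iJ]; rewrite setD1K.
  apply: eq_big => [J|J JT].
    rewrite setU11 andbT subUset sub1set iS /= subsetD1; congr (_ && _).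
    apply/idP/eqP => [iJ|<-]; first by rewrite setU1K.
    by rewrite !inE eqxx.
  have iJ : i \notin J by apply/negP => /(subsetP JT); rewrite !inE eqxx.
  have JS : i |: J \subset S.
    by rewrite subUset sub1set iS (subset_trans JT) ?subsetDl.
  have JE : #|S :\: (i |: J)| = #|T :\: J|.
    by apply: eq_card => j; rewrite !inE negb_or -andbA; case: (j == i); rewrite ?andbF.
  have WE : wt (i |: J) = (b i + wt J)%N by rewrite /wt big_setU1.
  rewrite /f /g JE /Z WE wA subnDl.
  have := after_Lexp (setU11 i J) JS SA; rewrite setU1K // => /(congr1 (fun k => q ^+ k)).
  rewrite !exprD => e.
  transitivity ((-1) ^+ #|T :\: J| * (1 - q ^+ (wt A' - wt J + r))^-1 * (1 - q ^+ b i) *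
    (q ^+ after A i * q ^+ Lexp A' T J)); first by rewrite /A' exprD; ring.
  by rewrite /T e exprD; ring.
(* For fixed [J] only the telescoping factor depends on [i]. *)
rewrite (eq_bigr _ step) (exchange_big_dep (fun J : {set 'I_n} => (J != set0) && (J \subset S))) /=.
  apply: eq_bigr => J /andP[_ JS].
  rewrite (eq_bigl (fun i => i \in J)); last first.
    move=> i; rewrite JS /=; have [iJ|] := boolP (i \in J); last by rewrite andbF.
    by rewrite (subsetP JS i iJ).
  rewrite -mulr_sumr telescope_subset /Z; last by move=> i /(subsetP JS) /Sm.
  by ring.
move=> i J iS /andP[-> iJ]; rewrite andbT.
by apply/set0Pn; exists i.
Qed.

End SubsetSum.

(** * Extracting one variable *)

Section PochhammerRatios.
Variables (K : fieldType) (q y : K).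
Hypotheses (q_neq0 : q != 0) (y_neq0 : y != 0).

Let qX k : q ^+ k != 0. Proof. exact: expf_neq0. Qed.

Let rev_denominator b k :
  qpoch q ((q ^+ k)^-1 / y) b =
  (- ((q ^+ k)^-1 / y)) ^+ b * \prod_(i < b) q ^+ i * qpoch q (y * q ^+ k.+1 / q ^+ b) b.
Proof.
rewrite qpoch_rev ?mulf_neq0 ?invr_eq0 //; congr (_ * qpoch _ (_ / _) _).
by rewrite exprS; field; rewrite ?q_neq0 ?y_neq0 ?qX ?oner_neq0.
Qed.

(** With [y = x_i / x_l], reversal makes the left side a run of factors [1 - y q^t] for
    [-b <= t < a]. The denominator occupies the window [k - b < t <= k], which fits since [k < a];
    the factors on both sides of it remain. *)
Lemma qpoch_ratio_after a b k : (k < a)%N ->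
  qpoch q y a * qpoch q (q * y^-1) b =
  q ^+ (k * b + b) * (qpoch q (y / q ^+ b) k.+1 * qpoch q (y * q ^+ k.+1) (a - k.+1))
  * qpoch q ((q ^+ k)^-1 / y) b.
Proof.
move=> ka; rewrite rev_denominator (@qpoch_rev _ _ (q * y^-1)) ?mulf_neq0 ?invr_eq0 //.
have -> : (q * y^-1)^-1 * q = y by field; rewrite ?q_neq0 ?y_neq0 ?qX ?oner_neq0.
have -> : - (q * y^-1) = q ^+ k.+1 * - ((q ^+ k)^-1 / y).
  by rewrite exprS; field; rewrite ?q_neq0 ?y_neq0 ?qX ?oner_neq0.
rewrite exprMn -exprM mulSn addnC.
have E : qpoch q (y / q ^+ b) b * qpoch q y a = qpoch q (y / q ^+ b) k.+1
    * qpoch q (y * q ^+ k.+1 / q ^+ b) b * qpoch q (y * q ^+ k.+1) (a - k.+1).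
  rewrite -[X in _ * qpoch q X a = _](divfK (qX b) y).
  rewrite -qpochD; have -> : (b + a = k.+1 + b + (a - k.+1))%N by rewrite addnAC subnKC // addnC.
  rewrite !qpochD addnC exprD; congr (_ * qpoch _ _ _ * qpoch _ _ _);
    by field; rewrite ?q_neq0 ?y_neq0 ?qX ?oner_neq0.
transitivity (q ^+ (b + k * b) * (- ((q ^+ k)^-1 / y)) ^+ b * \prod_(i < b) q ^+ i
  * (qpoch q (y / q ^+ b) b * qpoch q y a)); first by rewrite addnC; ring.
by rewrite E addnC; ring.
Qed.

(** For [l] before [i] the run is [-b < t <= a], so the same window fits already for [k <= a]. *)
Lemma qpoch_ratio_before a b k : (k <= a)%N ->
  qpoch q y^-1 b * qpoch q (q * y) a =
  q ^+ (k * b) * (qpoch q (y * q / q ^+ b) k * qpoch q (y * q ^+ k.+1) (a - k))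
  * qpoch q ((q ^+ k)^-1 / y) b.
Proof.
move=> ka; rewrite rev_denominator (@qpoch_rev _ _ y^-1) ?invr_eq0 // invrK.
have -> : - y^-1 = q ^+ k * - ((q ^+ k)^-1 / y) by field; rewrite ?q_neq0 ?y_neq0 ?qX ?oner_neq0.
rewrite exprMn -exprM.
have E : qpoch q (y * q / q ^+ b) b * qpoch q (q * y) a = qpoch q (y * q / q ^+ b) k
    * qpoch q (y * q ^+ k.+1 / q ^+ b) b * qpoch q (y * q ^+ k.+1) (a - k).
  have -> : q * y = y * q / q ^+ b * q ^+ b by rewrite divfK // mulrC.
  rewrite -qpochD; have -> : (b + a = k + b + (a - k))%N by rewrite addnAC subnKC // addnC.
  rewrite !qpochD addnC exprD exprS; congr (_ * qpoch _ _ _ * qpoch _ _ _);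
    by field; rewrite ?q_neq0 ?y_neq0 ?qX ?oner_neq0.
transitivity (q ^+ (k * b) * (- ((q ^+ k)^-1 / y)) ^+ b * \prod_(i < b) q ^+ i
  * (qpoch q (y * q / q ^+ b) b * qpoch q (q * y) a)); first by ring.
by rewrite E; ring.
Qed.

(** The crossing case: the denominator has one factor more than the reversed numerator, and this
    unbalanced reversal leaves the [- y] that makes the term divisible by [x_i]. *)
Lemma qpoch_ratio_short a b k : (k < a)%N ->
  qpoch q y a * qpoch q (q * y^-1) b =
  q ^+ (k * b.+1) * - y * (qpoch q (y / q ^+ b) k * qpoch q (y * q ^+ k.+1) (a - k.+1))
  * qpoch q ((q ^+ k)^-1 / y) b.+1.
Proof.
move=> ka; rewrite rev_denominator (@qpoch_rev _ _ (q * y^-1)) ?mulf_neq0 ?invr_eq0 //.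
have -> : (q * y^-1)^-1 * q = y by field; rewrite ?q_neq0 ?y_neq0 ?qX ?oner_neq0.
have E : qpoch q (y / q ^+ b) b * qpoch q y a = qpoch q (y / q ^+ b) k
    * qpoch q (y * q ^+ k.+1 / q ^+ b.+1) b.+1 * qpoch q (y * q ^+ k.+1) (a - k.+1).
  rewrite -[X in _ * qpoch q X a = _](divfK (qX b) y).
  rewrite -qpochD; have -> : (b + a = k + b.+1 + (a - k.+1))%N.
    by rewrite addnS -addSn addnAC subnKC // addnC.
  rewrite !qpochD exprD !exprS; congr (_ * qpoch _ _ _ * qpoch _ _ _);
    by field; rewrite ?q_neq0 ?y_neq0 ?qX ?oner_neq0.
have P : (- (q * y^-1)) ^+ b
    = q ^+ (k * b.+1) * - y * (- ((q ^+ k)^-1 / y)) ^+ b.+1 * q ^+ b.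
  have -> : - (q * y^-1) = q ^+ k.+1 * - ((q ^+ k)^-1 / y).
    by rewrite exprS; field; rewrite ?q_neq0 ?y_neq0 ?qX ?oner_neq0.
  by rewrite exprMn -exprM !exprS mulnS mulSn !exprD; field; rewrite ?q_neq0 ?y_neq0 ?qX ?oner_neq0.
rewrite P [\prod_(i < b.+1) _]big_ord_recr /=.
transitivity (q ^+ (k * b.+1) * - y * (- ((q ^+ k)^-1 / y)) ^+ b.+1 * q ^+ b * \prod_(i < b) q ^+ i
  * (qpoch q (y / q ^+ b) b * qpoch q y a)); first by ring.
by rewrite E; ring.
Qed.

End PochhammerRatios.

Lemma prod_pairs_setD1 (R : comNzRingType) n (p : 'I_n -> 'I_n -> R) (A : {set 'I_n}) i :
  i \in A ->
  \prod_(j in A) \prod_(l in A | (j < l)%N) p j l =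
  \prod_(l in A :\ i) (if (i < l)%N then p i l else p l i)
  * \prod_(j in A :\ i) \prod_(l in A :\ i | (j < l)%N) p j l.
Proof.
move=> iA; rewrite (big_setD1 i) //=.
have -> : \prod_(l in A | (i < l)%N) p i l = \prod_(l in A :\ i) (if (i < l)%N then p i l else 1).
  rewrite -big_mkcondr; apply: eq_bigl => l; rewrite !inE.
  by case: eqP => [->|//]; rewrite ltnn andbF.
rewrite [X in _ * X](eq_bigr (fun j : 'I_n => (if (j < i)%N then p j i else 1)
                      * \prod_(l in A :\ i | (j < l)%N) p j l)).
  rewrite big_split /= mulrA -big_split; congr (_ * _); apply: eq_bigr => l.
  rewrite !inE => /andP[li _]; case: ltngtP => [il|il|/val_inj il]; rewrite /= ?mulr1 ?mul1r //.
  by rewrite il eqxx in li.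
move=> j; rewrite !inE => /andP[ji jA]; case: ltnP => jlt.
  by rewrite (bigD1 i) ?iA //=; congr (_ * _); apply: eq_bigl => l; rewrite !inE andbC andbA.
rewrite mul1r; apply: eq_bigl => l; rewrite !inE.
by case: eqP => [->|//]; rewrite iA ltnNge jlt.
Qed.

Lemma mul_div_swap (K : fieldType) (a b c d : K) : a * c / (b * d) = d^-1 * a / b * c.
Proof. by rewrite invfM; ring. Qed.

(** The cancellation of the partial fraction denominator [D] against the pair factors, with the big
    products abstracted to variables. *)
Lemma residue_rearrange (K : fieldType) (V0 W xr qk c' D H E X M U P : K) : D != 0 ->
  V0 * W * (xr * qk * (c' / D) * H) * (E * X * M * U * D * P)
  = (E * qk * c') * ((V0 * xr * X) * ((W * M) * H * P * U)).
Proof. by move=> D0; field. Qed.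

Section Step.
Variables (F : fieldType) (q : F) (n n0 : nat) (b : 'I_n -> nat).
Hypothesis q_neq0 : q != 0.
Hypothesis q_order : forall k : nat, (0 < k)%N -> q ^+ k != 1.
Hypothesis b_gt0 : forall i : 'I_n, (n0 <= i)%N -> (0 < b i)%N.

Local Notation K := {fraction {mpoly F[n]}}.
Local Notation x := (@fvar F n).
Local Notation Q := (fconst n q).
Implicit Types (A : {set 'I_n}) (i j l : 'I_n) (v : 'I_n -> int).

Definition crossing i l : bool := (i < n0)%N && ~~ (l < n0)%N.

Definition alph (s : seq 'I_n) : seq K := [seq x i * Q ^+ k | i <- s, k <- iota 0 (b i)].

(** For [i < j] the exponent [a_j - chi(i <= n_0)] is [b_j], except for a crossing pair, where it is
    [b_j - 1]. *)
Definition pairf i j : K :=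
  qpoch Q (x i / x j) (b i) * qpoch Q (Q * x j / x i) (b j - crossing i j).

(* The Laurent polynomial whose constant term is D, restricted to the variables
   of A, with b_i standing for a_i - chi(i <= n_0). *)
Definition dterm A v la : K :=
  \prod_(i in A) x i ^ (- v i) * complete_sym_part (alph (enum A)) la
  * \prod_(i in A) \prod_(j in A | (i < j)%N) pairf i j.

Let pairf2 i l : K := if (i < l)%N then pairf i l else pairf l i.

Let Q_neq0 : Q != 0. Proof. by rewrite fconst_eq0. Qed.

Let laurent_monoV i l : l != i -> @laurent F n [set~ i] (x l)^-1.
Proof. by move=> li; apply: laurent_varV; rewrite !inE. Qed.

(* The factor on the right is the part of the partial fraction denominator of
   x_i q^k coming from x_l. *)
Lemma pair_ratio i l k : l != i -> (k < b i)%N ->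
  exists2 U, eqvar i U 1 &
  pairf2 i l = fconst n (q ^+ (k * b l + ((i < l)%N && ~~ crossing i l) * b l))
    * (if crossing i l then - (x i / x l) else 1) * U
    * qpoch Q ((Q ^+ k)^-1 * x l / x i) (b l).
Proof.
move=> li kb; pose y := x i / x l.
have y0 : y != 0 by rewrite mulf_neq0 ?invr_eq0 ?fvar_neq0.
have yV : y^-1 = x l / x i by rewrite invf_div.
have U1 c m c' m' : eqvar i (qpoch Q (y * fconst n c) m * qpoch Q (y * fconst n c') m') 1.
  rewrite -[X in eqvar _ _ X]mulr1; apply: eqvarM; rewrite /y -mulrA;
    by apply: eqvar_qpoch1; [exact: laurent_const | apply/laurentM/laurent_const/laurent_monoV].
rewrite fconstX /pairf2 /pairf.
case: ltngtP => [il|il|/val_inj il]; last by rewrite il eqxx in li.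
- have [cr|ncr] := boolP (crossing i l).
    have bl : b l = (b l).-1.+1.
      by rewrite prednK // b_gt0 // leqNgt; case/andP: cr.
    exists (qpoch Q (y * fconst n (q ^- (b l).-1)) k
       * qpoch Q (y * fconst n (q ^+ k.+1)) (b i - k.+1)); first exact: U1.
    rewrite subn1 /= mul0n addn0 fconstV !fconstX -[Q * _ / _]mulrA -[_ * x l / _]mulrA -yV -/y.
    by rewrite (qpoch_ratio_short Q_neq0 y0 (b l).-1 kb) -bl.
  exists (qpoch Q (y * fconst n (q ^- b l)) k.+1
     * qpoch Q (y * fconst n (q ^+ k.+1)) (b i - k.+1)); first exact: U1.
  rewrite subn0 /= mul1n mulr1 fconstV !fconstX -[Q * _ / _]mulrA -[_ * x l / _]mulrA -yV -/y.
  by rewrite (qpoch_ratio_after Q_neq0 y0 (b l) kb).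
have -> : crossing i l = false.
  rewrite /crossing; have [i0|] //= := ltnP i n0; rewrite (ltn_trans il) //.
(* If [(l, i)] is crossing, [x_i] carries the exponent [b i - 1]; hence only [k <= a] is
   available. *)
set a := (b i - _)%N; have ka : (k <= a)%N.
  apply: leq_trans (leq_sub2l (b i) (leq_b1 _)).
  by rewrite subn1 -ltnS prednK // (leq_ltn_trans _ kb).
exists (qpoch Q (y * fconst n (q / q ^+ b l)) k
     * qpoch Q (y * fconst n (q ^+ k.+1)) (a - k)); first exact: U1.
rewrite fconstM fconstV !fconstX mul0n addn0 mulr1 -[Q * _ / _]mulrA -[_ * x l / _]mulrA -yV -/y.
by rewrite (qpoch_ratio_before Q_neq0 y0 (b l) ka) -[y * Q / _]mulrA.
Qed.

(* The pair (i, k) stands for the letter x_i q^k. *)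
Definition slots (s : seq 'I_n) : seq ('I_n * nat) :=
  [seq (i, k) | i <- s, k <- iota 0 (b i)].

Let slot (p : 'I_n * nat) : K := x p.1 * Q ^+ p.2.

Lemma alph_slots s : alph s = map slot (slots s).
Proof. by rewrite /alph /slots map_allpairs. Qed.

Lemma mem_slots s p : (p \in slots s) = (p.1 \in s) && (p.2 < b p.1)%N.
Proof.
case: p => i k; apply/allpairsPdep/andP => [[j [m [js]]]|[/= si kb]].
  by rewrite mem_iota => mb [-> ->].
by exists i, k; rewrite mem_iota.
Qed.

Lemma slots_uniq s : uniq s -> uniq (slots s).
Proof.
move=> us; apply: allpairs_uniq_dep => //; first by move=> i _; apply: iota_uniq.
by move=> [i k] [j m] _ _ /= [-> ->].
Qed.

Let slot_neq0 p : slot p != 0.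
Proof.
rewrite /slot; apply: mulf_neq0; [exact: fvar_neq0 | exact: (expf_neq0 _ Q_neq0)].
Qed.

Let qX_inj : injective (fun k => q ^+ k).
Proof.
move=> k m e; wlog km : k m e / (k <= m)%N.
  by case: (leqP k m) => [?|/ltnW ?] H; [|symmetry]; apply: H.
apply/eqP; rewrite eqn_leq km /= -subn_eq0 -leqn0 leqNgt; apply/negP => /q_order.
by rewrite -(inj_eq (mulfI (expf_neq0 k q_neq0))) -exprD subnKC // mulr1 e eqxx.
Qed.

Let slot_inj : injective slot.
Proof.
move=> [i k] [j m]; rewrite /slot /= -!fconstX => /fvar_const_inj.
by rewrite expf_neq0 // => /(_ isT) [-> /qX_inj ->].
Qed.

(** In the ratios of letters of [x_i] the variable cancels and a constant remains; the letters of
    each other [x_l] assemble into the factor split off by [pair_ratio]. *)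
Lemma slot_denominator A i k : i \in A ->
  \prod_(p <- slots (enum A) | p != (i, k)) (1 - slot p / slot (i, k)) =
  fconst n (\prod_(m <- iota 0 (b i) | m != k) (1 - q ^+ m / q ^+ k))
  * \prod_(l in A :\ i) qpoch Q ((Q ^+ k)^-1 * x l / x i) (b l).
Proof.
move=> iA; rewrite big_mkcond big_allpairs_dep big_enum /= (big_setD1 i) //=.
congr (_ * _).
  rewrite fconst_prod [RHS]big_mkcond; apply: eq_bigr => m _.
  rewrite xpair_eqE eqxx /=; case: eqP => //= _.
  rewrite fconstB fconst1 fconstM fconstV !fconstX /slot /= invfM mulrACA.
  by rewrite divff ?fvar_neq0 // mul1r.
apply: eq_bigr => l; rewrite !inE => /andP[li _].
rewrite /qpoch -(big_mkord xpredT (fun m => 1 - (Q ^+ k)^-1 * x l / x i * Q ^+ m)).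
rewrite /index_iota subn0; apply: eq_bigr => m _; rewrite xpair_eqE (negPf li) /=.
by rewrite /slot /= mul_div_swap.
Qed.

Definition cross A i := (\sum_(l in A :\ i) crossing i l)%N.
Definition shift A i := (\sum_(l in A :\ i | (i < l)%N && ~~ crossing i l) b l)%N.

Lemma pairf_laurent i j l : j != i -> l != i -> laurent [set~ i] (pairf j l).
Proof.
move=> ji li; have Dj : j \in [set~ i] by rewrite !inE.
have Dl : l \in [set~ i] by rewrite !inE.
apply: laurentM; apply: laurent_qpoch; try exact: laurent_const.
  by apply: laurentM; [exact: laurent_var|exact: laurent_varV].
apply/laurentM; last exact: laurent_varV.
by apply: laurentM; [exact: laurent_const|exact: laurent_var].
Qed.

Lemma alph_laurent D s y : y \in alph s -> laurent D y.
Proof.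
move=> /allpairsPdep[i [k [_ _ ->]]]; apply: laurentM; first exact: laurent_var.
exact/laurentX/laurent_const.
Qed.

Lemma eqvar_alph A i la : i \in A ->
  eqvar i (complete_sym_part (alph (enum A)) la) (complete_sym_part (alph (enum (A :\ i))) la).
Proof.
move=> iA; have P : perm_eq (enum A) (i :: enum (A :\ i)).
  apply: uniq_perm; rewrite /= ?enum_uniq ?mem_enum ?inE ?eqxx // => j.
  by rewrite !inE !mem_enum !inE; case: eqP => [->|].
have -> : complete_sym_part (alph (enum A)) la
    = complete_sym_part (alph [:: i] ++ alph (enum (A :\ i))) la.
  rewrite -allpairs_cat; apply: eq_bigr => l _; apply: eq_complete_sym.
  exact: perm_allpairs_dep.
apply: eqvar_complete_sym_part; first exact: alph_laurent.
move=> y /allpairsPdep[j [k [+ _ ->]]]; rewrite inE => /eqP ->.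
by exists (Q ^+ k) => //; apply/laurentX/laurent_const.
Qed.

Definition residue_coef A i k r : F :=
  (-1) ^+ cross A i * q ^+ (k * wt b (A :\ i) + shift A i) * q ^+ (k * r)
  / \prod_(m <- iota 0 (b i) | m != k) (1 - q ^+ m / q ^+ k).

(** The [x_l^-1] left behind by a crossing factor [- x_i / x_l] counts as an increase of [v_l]. *)
Definition shifted i v l : int := v l + (crossing i l)%:Z.

Lemma residue_term A v la i k r : i \in A -> (k < b i)%N ->
  exists2 g, eqvar i g (dterm (A :\ i) (shifted i v) la) &
  \prod_(j in A) x j ^ (- v j)
  * (slot (i, k) ^+ r / \prod_(p <- slots (enum A) | p != (i, k)) (1 - slot p / slot (i, k))
     * complete_sym_part (alph (enum A)) la)
  * \prod_(j in A) \prod_(l in A | (j < l)%N) pairf j l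
  = fconst n (residue_coef A i k r) * (x i ^ ((r + cross A i)%:Z - v i) * g).
Proof.
move=> iA kb.
have li_of l : l \in A :\ i -> l != i by rewrite !inE => /andP[].
(* The cofactors are chosen for all [l] at once; the guard [l != i] makes the choice total. *)
have /fin_all_exists2[U HU EU] : forall l, exists2 U, l != i -> eqvar i U 1 &
    l != i -> pairf2 i l = fconst n (q ^+ (k * b l + ((i < l)%N && ~~ crossing i l) * b l))
      * (if crossing i l then - (x i / x l) else 1) * U
      * qpoch Q ((Q ^+ k)^-1 * x l / x i) (b l).
  move=> l; have [->|li] := eqVneq l i; first by exists 1.
  by have [U ? ?] := pair_ratio li kb; exists U.
have D0 : \prod_(l in A :\ i) qpoch Q ((Q ^+ k)^-1 * x l / x i) (b l) != 0.
  apply/prodf_neq0 => l /li_of li; apply/prodf_neq0 => m _.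
  rewrite -mul_div_swap subr_eq0 eq_sym -[x l * _]/(slot (l, nat_of_ord m)).
  apply: contra li => /eqP /(canRL (divfK (slot_neq0 (i, k)))).
  by rewrite mul1r => /slot_inj [/eqP].
have pE : \prod_(l in A :\ i) pairf2 i l =
    fconst n ((-1) ^+ cross A i * q ^+ (k * wt b (A :\ i) + shift A i))
    * x i ^+ cross A i * (\prod_(l in A :\ i) (x l)^-1 ^+ crossing i l)
    * (\prod_(l in A :\ i) U l) * (\prod_(l in A :\ i) qpoch Q ((Q ^+ k)^-1 * x l / x i) (b l)).
  have -> : fconst n ((-1) ^+ cross A i * q ^+ (k * wt b (A :\ i) + shift A i))
    = \prod_(l in A :\ i) fconst n ((-1) ^+ crossing i l
          * q ^+ (k * b l + ((i < l)%N && ~~ crossing i l) * b l)).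
    rewrite -fconst_prod big_split /= !prodrXr; congr (fconst n (_ * q ^+ _)).
    rewrite big_split /= big_distrr; congr (_ + _)%N.
    by rewrite /shift big_mkcondr; apply: eq_bigr => l _; case: (_ && _); rewrite ?mul1n ?mul0n.
  rewrite -prodrXr -!big_split; apply: eq_bigr => l /li_of li /=; rewrite EU // fconstM.
  congr (_ * _ * _); rewrite -!mulrA [RHS]mulrCA; congr (_ * _).
  case: crossing; last by rewrite !expr0 fconst1 !mulr1.
  by rewrite !expr1 /fconst !rmorphN !rmorph1 mulN1r.
rewrite (prod_pairs_setD1 _ iA) -[\prod_(l in A :\ i) _]/(\prod_(l in A :\ i) pairf2 i l).
rewrite pE (big_setD1 i iA) /= slot_denominator // invfM -fconstV.
rewrite /slot /= exprMn residue_rearrange //.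
rewrite -!fconstX -!fconstM -exprM -/(residue_coef A i k r).
eexists; last first.
  congr (_ * (_ * _)); rewrite [_%:Z - _]addrC PoszD !expfzDr ?fvar_neq0 //.
  by rewrite -!exprnP mulrA.
rewrite /dterm -[X in eqvar _ _ X]mulr1; apply: eqvarM; last first.
  rewrite [X in eqvar _ _ X](_ : 1 = \prod_(l in A :\ i) (1 : K)); last by rewrite big1.
  by apply: eqvar_prod => l _ /li_of; apply: HU.
apply: eqvarM; last first.
  apply/eqvar_refl/laurent_prod => j _ /li_of ji; apply: laurent_prod => l _ /andP[/li_of li _].
  exact: pairf_laurent.
apply: eqvarM; last exact: eqvar_alph.
rewrite -big_split; have -> : \prod_(l in A :\ i) x l ^ (- shifted i v l) =
    \prod_(l in A :\ i) (x l ^ (- v l) * (x l)^-1 ^+ crossing i l).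
  apply: eq_bigr => l _; rewrite /shifted opprD expfzDr ?fvar_neq0 //; congr (_ * _).
  by rewrite -exprz_inv -exprnP.
apply/eqvar_refl/laurent_prod => l _ /li_of li; apply: laurentM.
  by apply: laurent_varZ; rewrite !inE.
exact/laurentX/laurent_monoV.
Qed.

Lemma CT_residue i c d g g' : eqvar i g g' ->
  CT (fconst n c * (x i ^+ d * g)) = (d == 0%N)%:R * c * CT g'.
Proof.
move=> e; have Hg := eqvar_laurent e; case: d => [|d].
  by rewrite expr0 !mul1r (CT_constM _ Hg) (eqvar_CT e).
rewrite (@CT_constM _ _ [set~ i]); last exact/laurentM/Hg/laurentX/laurent_var.
rewrite exprS -mulrA CT_varM ?mulr0 ?mul0r //.
exact/laurentM/Hg/laurentX/laurent_var.
Qed.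

(** The powers of [q^k] from the letter and from the pair factors merge into one exponent, so the
    sum is the partial fraction expansion of a complete symmetric function of
    [1, q, .., q^(b_i - 1)], read backwards. *)
Lemma residue_coef_sum A i r :
  \sum_(k <- iota 0 (b i)) residue_coef A i k r.+1 = 
  (-1) ^+ cross A i * q ^+ shift A i
  * complete_sym [seq q ^+ k | k <- iota 0 (b i)] (r.+1 + wt b (A :\ i)).
Proof.
case: (posnP (b i)) => [->|bi]; first by rewrite big_nil addSn complete_sym_nil mulr0.
rewrite complete_sym_partial_fractions ?iota_uniq //; last 3 first.
- by rewrite -size_eq0 size_iota -lt0n.
- by move=> k m _ _; apply: qX_inj.
- by move=> k; apply: expf_neq0.
rewrite mulr_sumr; apply: eq_bigr => k _; rewrite /residue_coef mulrA; congr (_ / _).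
by rewrite mulnC -!mulrA -exprM -!exprD; congr (_ * q ^+ _); ring.
Qed.

(** The bound on [v] makes the exponent of [x_i] nonnegative in the terms coming from [x_i]; a
    positive exponent kills the constant term, and exponent 0 gives the value at [x_i = 0]. *)
Lemma CT_dterm_step A v la r :
  (forall i, i \in A -> v i <= (r.+1 + cross A i)%:Z) ->
  CT (dterm A v (r.+1 :: la)) =
  \sum_(i in A | v i == (r.+1 + cross A i)%:Z)
    (-1) ^+ cross A i * q ^+ shift A i
    * complete_sym [seq q ^+ k | k <- iota 0 (b i)] (r.+1 + wt b (A :\ i))
    * CT (dterm (A :\ i) (shifted i v) la).
Proof.
move=> vr; have us := slots_uniq (enum_uniq A).
have hE : complete_sym (alph (enum A)) r.+1 = \sum_(p <- slots (enum A))
    slot p ^+ r.+1 / \prod_(p' <- slots (enum A) | p' != p) (1 - slot p' / slot p).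
  rewrite alph_slots; have [->|s0] := eqVneq (slots (enum A)) [::].
    by rewrite /= complete_sym_nil big_nil.
  by apply: complete_sym_partial_fractions => // p p' _ _; apply: slot_inj.
pose t p := \prod_(j in A) x j ^ (- v j)
  * (slot p ^+ r.+1 / \prod_(p' <- slots (enum A) | p' != p) (1 - slot p' / slot p)
     * complete_sym_part (alph (enum A)) la)
  * \prod_(j in A) \prod_(l in A | (j < l)%N) pairf j l.
have E : dterm A v (r.+1 :: la) = \sum_(p <- slots (enum A)) t p.
  rewrite /dterm /complete_sym_part big_cons hE mulr_suml mulr_sumr mulr_suml.
  by apply: eq_bigr.
have tE i k : i \in A -> (k < b i)%N -> exists2 g, eqvar i g (dterm (A :\ i) (shifted i v) la) &
    t (i, k) = fconst n (residue_coef A i k r.+1) * (x i ^+ `|(r.+1 + cross A i)%:Z - v i|%N * g).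
  move=> iA kb; have [g Hg Eg] := residue_term v la r.+1 iA kb; exists g => //.
  by rewrite /t Eg exprnP gez0_abs // subr_ge0 vr.
rewrite E (@CT_sum _ _ setT) => [|[i k]]; last first.
  rewrite mem_slots mem_enum => /andP[iA kb]; have [g Hg ->] := tE i k iA kb.
  apply/laurentM/laurentM/(laurent_sub _ (eqvar_laurent Hg)); [exact: laurent_const| |].
    exact/laurentX/laurent_var.
  exact: subsetT.
rewrite big_allpairs_dep big_enum [RHS]big_mkcondr; apply: eq_bigr => i iA.
transitivity ((v i == (r.+1 + cross A i)%:Z)%:R * (\sum_(k <- iota 0 (b i)) residue_coef A i k r.+1)
   * CT (dterm (A :\ i) (shifted i v) la)).
  rewrite mulr_sumr mulr_suml; apply: eq_big_seq => k; rewrite mem_iota => kb.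
  have [g Hg ->] := tE i k iA kb; rewrite (CT_residue _ _ Hg); congr (_%:R * _ * _).
  by rewrite absz_eq0 subr_eq0 eq_sym.
by rewrite residue_coef_sum; case: eqP => _; rewrite ?mul1r ?mul0r.
Qed.

End Step.

(** * Relabelling and iteration *)

Lemma eq_dterm (F : fieldType) (q : F) n n0 (b : 'I_n -> nat) (A : {set 'I_n})
    (v v' : 'I_n -> int) la :
  {in A, v =1 v'} -> dterm q n0 b A v la = dterm q n0 b A v' la.
Proof. by move=> vv'; congr (_ * _ * _); apply: eq_bigr => i /vv' ->. Qed.

(** The map [s] lists [A] increasingly, so renaming respects the pair factors, which depend on the
    order of the indices. *)
Lemma dysonD_dterm (F : fieldType) (q : F) n' n0' n n0 (s : 'I_n' -> 'I_n)
    (A : {set 'I_n}) (a : seq nat) (v' : seq int) (b : 'I_n -> nat) v la :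
  (forall i j, (s i < s j)%N = (i < j)%N) -> enum A = map s (enum 'I_n') ->
  (forall j, (s j < n0)%N = (j < n0')%N) ->
  (forall j : 'I_n', (nth 0%N a j - (j < n0'))%N = b (s j)) ->
  (forall j : 'I_n', v'`_j = v (s j)) ->
  dysonD q n' n0' a v' la = CT (dterm q n0 b A v la).
Proof.
move=> mono enumA sn0 ab vv'.
have s_inj : injective s.
  move=> i j e; apply/val_inj/eqP; have := (mono i j, mono j i).
  by rewrite e ltnn => -[/esym + /esym +]; case: ltngtP.
have bigA (R : comNzRingType) (P : pred 'I_n) (f : 'I_n -> R) :
    \prod_(i in A | P i) f i = \prod_(j < n' | P (s j)) f (s j).
  by rewrite -big_enum_cond enumA big_map big_enum_cond.
rewrite /dysonD /dterm; apply: (relabelled_CT s_inj); apply: relabelledM; first apply: relabelledM.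
- have -> : \prod_(i in A) fvar F i ^ (- v i) = \prod_(j < n') fvar F (s j) ^ (- v (s j)).
    by rewrite -(bigA _ predT (fun i => fvar F i ^ (- v i))); apply: eq_bigl => i; rewrite andbT.
  by apply: relabelled_prod => j _ _; rewrite vv'; apply: relabelled_varZ.
- apply: relabelled_prod => l _ _.
  pose cells (i : 'I_n') := iota 0 (nth 0%N a i - (i < n0')).
  have -> : alph q b (enum A) = map (fun p : 'I_n' * nat => fvar F (s p.1) * fconst n q ^+ p.2)
      [seq (i, k) | i <- enum 'I_n', k <- cells i].
    rewrite map_allpairs /alph enumA allpairs_mapl /=.
    by congr flatten; apply: eq_map => i; rewrite /cells ab.
  have -> : alphabet q n' n0' a = map (fun p : 'I_n' * nat => fvar F p.1 * fconst n' q ^+ p.2)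
      [seq (i, k) | i <- enum 'I_n', k <- cells i].
    by rewrite map_allpairs.
  apply: relabelled_complete_sym => -[i k] _ /=; apply: relabelledM; first exact: relabelled_var.
  exact/relabelledX/relabelled_const.
have -> : \prod_(i in A) \prod_(j in A | (i < j)%N) pairf q n0 b i j =
    \prod_(i < n') \prod_(j < n' | (i < j)%N) pairf q n0 b (s i) (s j).
  transitivity (\prod_(i in A | predT i) \prod_(j in A | (i < j)%N) pairf q n0 b i j).
    by apply: eq_bigl => i; rewrite andbT.
  rewrite bigA; apply: eq_bigr => i _; rewrite bigA; apply: eq_bigl => j; exact: mono.
apply: relabelled_prod => i _ _; apply: relabelled_prod => j _ ij.
rewrite /pairf ab; have -> : (nth 0%N a j - (i < n0') = b (s j) - crossing n0 (s i) (s j))%N.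
  rewrite -ab /crossing !sn0; case: (ltnP j n0') => jn0; last by rewrite andbT subn0.
  by rewrite (ltn_trans ij jn0) andbF subn0.
by apply: relabelledM; apply: relabelled_qpoch; repeat first
  [exact: relabelled_const | exact: relabelled_var | exact: relabelled_varV | apply: relabelledM].
Qed.

(** The entries below [m] form an initial segment. This locates the boundary between the two blocks
    after renumbering. *)
Lemma sorted_nth_ltn_count (s : seq nat) m j : sorted ltn s -> (j < size s)%N ->
  (nth 0%N s j < m)%N = (j < count (fun i => (i < m)%N) s)%N.
Proof.
elim: s j => [|h s IH] j //= hs js; have [hm|mh] := ltnP h m.
  by case: j js => [//|j] js; rewrite add1n ltnS -IH //= (path_sorted hs).
have hs' : all (ltn h) s by exact: (order_path_min ltn_trans hs).
have -> : count (fun i => (i < m)%N) s = 0%N.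
  apply/eqP; rewrite -leqn0 leqNgt -has_count -all_predC.
  by apply: sub_all hs' => i /= hi; rewrite -leqNgt (leq_trans mh) // ltnW.
rewrite ltn0; apply/negbTE; rewrite -leqNgt; case: j js => [//|j] js /=.
by apply: leq_trans mh (ltnW _); apply: (all_nthP 0%N hs').
Qed.

Lemma sorted_enum_set n (A : {set 'I_n}) : sorted ltn (map val (enum A)).
Proof.
rewrite sorted_map {1}/enum_mem; apply: sorted_filter.
  by move=> i j k; apply: ltn_trans.
rewrite -sorted_map; have := iota_ltn_sorted 0 n; rewrite -val_enum_ord enumT.
exact.
Qed.

Lemma map_enum_val (T : finType) (A : {set T}) : map enum_val (enum 'I_#|A|) = enum A.
Proof.
have sz : size (map enum_val (enum 'I_#|A|)) = size (enum A).
  by rewrite size_map size_enum_ord cardE.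
case E: (enum A) => [|x0 t]; first by apply: size0nil; rewrite sz E.
rewrite -E; apply: (@eq_from_nth _ x0); rewrite sz // -cardE => i iA.
by rewrite (nth_map (Ordinal iA)) ?size_enum_ord // (enum_val_nth x0) nth_enum_ord.
Qed.

Lemma dysonD_delete (F : fieldType) (q : F) n n0 n0' (a : n.-tuple nat) (v : n.-tuple int)
    (S : {set 'I_n}) la :
  #|[set i in ~: S | (i < n0)%N]| = n0' ->
  dysonD q (n - #|S|) n0' (delete S a) (delete S v) la
  = CT (dterm q n0 (fun i => (tnth a i - (i < n0))%N) (~: S) (tnth v) la).
Proof.
move=> cn0; have -> : (n - #|S|)%N = #|~: S| by rewrite [RHS]cardsCs setCK card_ord.
pose s (j : 'I_#|~: S|) := enum_val j.
have sE (j : 'I_#|~: S|) : val (s j) = nth 0%N (map val (enum (~: S))) j.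
  by rewrite (nth_map (s j)) -?cardE //; congr val; exact: enum_val_nth.
have dE T (x0 : T) (t : n.-tuple T) (j : 'I_#|~: S|) : nth x0 (delete S t) j = tnth t (s j).
  rewrite /delete (nth_map (s j)) -?cardE //; congr tnth; exact/esym/enum_val_nth.
have srt := sorted_enum_set (~: S).
have sn0 (j : 'I_#|~: S|) : (s j < n0)%N = (j < n0')%N.
  rewrite -[nat_of_ord (s j)]/(val (s j)) sE sorted_nth_ltn_count ?size_map -?cardE //.
  rewrite count_map -cn0; congr (_ < _)%N.
  rewrite -size_filter cardE; apply/perm_size/uniq_perm; rewrite ?enum_uniq ?(filter_uniq _ (enum_uniq _)) // => i.
  by rewrite mem_filter !mem_enum !inE andbC.
apply: (@dysonD_dterm F q _ n0' n n0 s) => //.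
- have homo (i j : 'I_#|~: S|) : (i < j)%N -> (s i < s j)%N.
    rewrite -[nat_of_ord (s i)]/(val (s i)) -[nat_of_ord (s j)]/(val (s j)) !sE.
    by apply: (sorted_ltn_nth ltn_trans 0%N srt); rewrite inE size_map -cardE.
  move=> i j; apply/idP/idP => [|/homo //]; apply: contraLR; rewrite -!leqNgt leq_eqVlt.
  by case/orP => [/eqP/val_inj ->|/homo/ltnW].
- exact/esym/map_enum_val.
- by move=> j; rewrite dE sn0.
Qed.

(** * Deleting all of S, one variable at a time *)

Section Elimination.
Variables (F : fieldType) (q : F) (n n0 : nat) (b : 'I_n -> nat).
Hypothesis q_neq0 : q != 0.
Hypothesis q_order : forall k : nat, (0 < k)%N -> q ^+ k != 1.
Hypothesis b_gt0 : forall i : 'I_n, (n0 <= i)%N -> (0 < b i)%N.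
Variables (m r c : nat) (e : 'I_n -> nat) (S : {set 'I_n}) (v : 'I_n -> int).

(* After the deletion of S :\: U, the deleted variables have shifted the
   exponents of the others by e. *)
Definition remaining (U : {set 'I_n}) := ~: (S :\: U).
Definition exponents (U : {set 'I_n}) l : int := v l + (#|S :\: U| * e l)%:Z.

Hypothesis S_m : {in S, forall i : 'I_n, (i < m)%N}.
Hypothesis crossingE : {in S, forall i l : 'I_n, crossing n0 i l = e l :> nat}.
Hypothesis afterE : {in S, forall i l : 'I_n, (i < l)%N && ~~ crossing n0 i l = (i < l < m)%N}.
Hypothesis crossE : forall U : {set 'I_n}, U \subset S ->
  {in U, forall i : 'I_n, cross n0 (remaining U) i = c}.
(** While [U] is nonempty, equality singles out [U], so each step is a sum over the elements of S
    not yet deleted. *)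
Hypothesis exponents_le : forall U : {set 'I_n}, U \subset S -> U != set0 ->
  {in remaining U, forall i : 'I_n, (exponents U i <= (r.+1 + cross n0 (remaining U) i)%:Z)
    && ((exponents U i == (r.+1 + cross n0 (remaining U) i)%:Z) == (i \in U))}.

(** The quotient of q-multinomial coefficients of the theorem after cancellation of the factors
    common to both; [r] plays the role of [r - 1] there. *)
Definition prefactor (A U : {set 'I_n}) : F :=
  qpoch q q (wt b A + r)
  / (qpoch q q (wt b A - wt b U + r) * \prod_(i in U) qpoch q q (b i)).

Lemma prefactor_step (A U : {set 'I_n}) i : i \in U -> U \subset A ->
  complete_sym [seq q ^+ k | k <- iota 0 (b i)] (r.+1 + wt b (A :\ i)) * prefactor (A :\ i) (U :\ i)
  = prefactor A U * ((1 - q ^+ b i) / (1 - q ^+ (wt b A - b i + r.+1))).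
Proof.
move=> iU UA; have iA := subsetP UA i iU.
rewrite addSn complete_sym_qpowers // /prefactor (big_setD1 i iU) /=.
rewrite (wtD1 b iA) (wtD1 b iU) subnDl addKn addnS qpochS -exprS (addnC r) -addnA (addnC (b i)).
rewrite addnAC [(_ + (r + _))%N]addnA.
have D : 1 - q ^+ (wt b (A :\ i) + r).+1 != 0 by rewrite subr_eq0 eq_sym q_order.
have P : \prod_(j in U :\ i) qpoch q q (b j) != 0.
  by apply/prodf_neq0 => j _; apply: qpoch_neq0.
have := (qpoch_neq0 q_order (b i), qpoch_neq0 q_order (wt b (A :\ i) + r),
         qpoch_neq0 q_order (wt b (A :\ i) - wt b (U :\ i) + r)) => -[[? ?] ?].
by field; do ?[apply/andP; split].
Qed.

(** Induction on the size of [U]. The q-binomial factors telescope by [prefactor_step], and what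
    remains is the recursion [jsum_rec]. *)
Lemma CT_dterm_eliminate la (U : {set 'I_n}) : U \subset S ->
  CT (dterm q n0 b (remaining U) (exponents U) (nseq #|U| r.+1 ++ la))
  = (-1) ^+ (#|U| * c) * prefactor (remaining U) U * jsum1 q b m r.+1 (remaining U) U
    * CT (dterm q n0 b (remaining set0) (exponents set0) la).
Proof.
move: {2}#|U| (erefl #|U|) => k; elim: k U => [|k IH] U cU US.
  move/eqP: (cU); rewrite cards_eq0 => /eqP U0; rewrite cU U0 mul0n expr0 mul1r.
  have w0 : wt b (set0 : {set 'I_n}) = 0%N by rewrite /wt big_set0.
  rewrite /jsum1 eqxx mulr1 /prefactor w0 big_set0 subn0 mulr1 divff ?mul1r //.
  exact: qpoch_neq0.
have U0 : U != set0 by rewrite -cards_eq0 cU.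
set A := remaining U; have UA : U \subset A.
  by apply/subsetP => i iU; rewrite !inE iU.
rewrite cU /= CT_dterm_step //; last by move=> i iA; have /andP[] := exponents_le US U0 iA.
rewrite (eq_bigl (fun i => i \in U)); last first.
  move=> i; have [iA|] := boolP (i \in A); first by have /andP[_ /eqP] := exponents_le US U0 iA.
  by move=> iA; apply/esym/negbTE; apply: contra iA => /(subsetP UA).
rewrite /jsum1 (negPf U0) jsum_rec //; last by move=> i /(subsetP US) /S_m.
rewrite mulr_sumr mulr_suml; apply: eq_bigr => i iU; have iS := subsetP US i iU.
have AE : A :\ i = remaining (U :\ i).
  by apply/setP => j; rewrite !inE; case: eqP => [->|] //=; rewrite iS.
have SU : #|S :\: (U :\ i)| = #|S :\: U|.+1.
  rewrite (cardsD1 i (S :\: (U :\ i))) !inE eqxx iS add1n; congr _.+1; apply: eq_card => j.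
  by rewrite !inE; case: eqP => [->|] //=; rewrite iU.
have -> : shift n0 b A i = after b m A i.
  rewrite /shift /after; rewrite (eq_bigl (fun l => (l \in A) && (i < l < m)%N)) // => l.
  by rewrite afterE // !inE; case: eqP => [->|] //=; rewrite ltnn !andbF.
rewrite crossE // AE (eq_dterm _ _ _ (v' := exponents (U :\ i))); last first.
  by move=> l _; rewrite /shifted /exponents crossingE // SU mulSn addnC PoszD addrA.
have cUi : #|U :\ i| = k by move: cU; rewrite (cardsD1 i U) iU => -[].
have := IH (U :\ i) cUi (subset_trans (subsetDl _ _) US); rewrite cUi => ->; rewrite -AE.
rewrite mulSn exprD.
have := prefactor_step iU UA; set h := complete_sym _ _ => E.
transitivity ((-1) ^+ c * (-1) ^+ (k * c) * q ^+ after b m A i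
  * (h * prefactor (A :\ i) (U :\ i)) * jsum1 q b m r.+1 (A :\ i) (U :\ i)
  * CT (dterm q n0 b (remaining set0) (exponents set0) la)); first by ring.
by rewrite E; ring.
Qed.

End Elimination.

Lemma dysonD_eliminate (F : fieldType) (q : F) (q_neq0 : q != 0)
    (q_order : forall k : nat, (0 < k)%N -> q ^+ k != 1)
    (n n0 n0' m r c : nat) (a : n.-tuple nat) (v w : n.-tuple int)
    (e : 'I_n -> nat) (S : {set 'I_n}) (la : seq nat) :
  let ta : n.-tuple nat := [tuple (tnth a i - (i < n0))%N | i < n] in
  (forall i, 0 < tnth a i)%N ->
  S != set0 ->
  #|[set i in ~: S | (i < n0)%N]| = n0' ->
  (forall l, tnth w l = tnth v l + (#|S| * e l)%:Z) ->
  {in S, forall i : 'I_n, (i < m)%N} ->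
  {in S, forall i l : 'I_n, crossing n0 i l = e l :> nat} ->
  {in S, forall i l : 'I_n, (i < l)%N && ~~ crossing n0 i l = (i < l < m)%N} ->
  (forall U : {set 'I_n}, U \subset S ->
    {in U, forall i : 'I_n, cross n0 (remaining S U) i = c}) ->
  (forall U : {set 'I_n}, U \subset S -> U != set0 ->
    {in remaining S U, forall i : 'I_n,
      (exponents e S (tnth v) U i <= (r.+1 + cross n0 (remaining S U) i)%:Z)
      && ((exponents e S (tnth v) U i == (r.+1 + cross n0 (remaining S U) i)%:Z) == (i \in U))}) ->
  dysonD q n n0 a v (nseq #|S| r.+1 ++ la) =
  (-1) ^+ (#|S| * c)
  * (qmultinomial q (sumn ta + r) (rcons ta r)
     / qmultinomial q (sumn ta - subsum S ta + r) (rcons (delete S ta) r))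
  * (\sum_(J : {set 'I_n} | (J != set0) && (J \subset S))
      (-1) ^+ #|S :\: J| * q ^+ Lsum m S J ta
      * ((1 - q ^+ subsum J ta) / (1 - q ^+ (sumn ta - subsum J ta + r.+1)))
      * dysonD q (n - #|S|) n0' (delete S a) (delete S w) la).
Proof.
move=> ta a_gt0 S0 cn0 wE Sm crE afE cE ev.
pose b (i : 'I_n) := (tnth a i - (i < n0))%N.
have bE i : tnth ta i = b i by rewrite tnth_mktuple.
have b_gt0 (i : 'I_n) : (n0 <= i)%N -> (0 < b i)%N by move=> ni; rewrite /b [(i < n0)%N]ltnNge ni subn0.
have -> : dysonD q n n0 a v (nseq #|S| r.+1 ++ la)
    = CT (dterm q n0 b setT (tnth v) (nseq #|S| r.+1 ++ la)).
  apply: (@dysonD_dterm F q n n0 n n0 id) => // [|i|i].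
  - rewrite map_id enumT; apply/all_filterP/allP => i _; exact: in_setT.
  - by rewrite -tnth_nth.
  - by rewrite -tnth_nth.
have RS : remaining S S = setT by rewrite /remaining setDv setC0.
(* At the start [U = S]: nothing is deleted yet and no exponent has moved. *)
have -> : dterm q n0 b setT (tnth v) (nseq #|S| r.+1 ++ la)
    = dterm q n0 b (remaining S S) (exponents e S (tnth v) S) (nseq #|S| r.+1 ++ la).
  by rewrite RS; apply: eq_dterm => i _; rewrite /exponents setDv cards0 mul0n addr0.
rewrite (CT_dterm_eliminate q_neq0 q_order b_gt0 Sm crE afE cE ev) // RS /jsum1 (negPf S0).
rewrite -mulr_suml mulrA; congr (_ * _); last first.
  rewrite (dysonD_delete _ _ _ _ cn0) /remaining setD0; congr CT; apply: eq_dterm => i _.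
  by rewrite /exponents setD0 wE.
have wtE T : wt b T = subsum T ta by apply: eq_bigr => i _; rewrite bE.
have wTE : wt b [set: 'I_n] = sumn ta.
  rewrite sumnE big_tuple; apply: eq_big => i; rewrite ?inE // => _; exact/esym/bE.
congr (_ * _ * _); last first.
  rewrite /jsum; apply: eq_bigr => J _; rewrite wTE !wtE; congr (_ * q ^+ _ * _).
  by apply: eq_bigr => i _; apply: eq_big => j; rewrite ?inE // bE.
rewrite /prefactor /qmultinomial wTE wtE -!cats1 !big_cat !big_seq1 /=.
have -> : \prod_(k <- ta) qpoch q q k
    = \prod_(i in S) qpoch q q (b i) * \prod_(k <- delete S ta) qpoch q q k.
  rewrite /delete big_map big_enum big_tuple (bigID (mem S)) /=; congr (_ * _).
    by apply: eq_bigr => i _; rewrite bE.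
  by apply: eq_bigl => i; rewrite inE.
have P1 : \prod_(i in S) qpoch q q (b i) != 0.
  by apply/prodf_neq0 => j _; apply: qpoch_neq0.
have P2 : \prod_(k <- delete S ta) qpoch q q k != 0.
  by rewrite prodf_seq_neq0; apply/allP => j _; apply: qpoch_neq0.
have := (qpoch_neq0 q_order (sumn ta - subsum S ta + r), qpoch_neq0 q_order r) => -[? ?].
by field; do ?[apply/andP; split].
Qed.

(** * Index counts and bounds for the two cases *)

Lemma nseq_cat_drop (s x : nat) (la : seq nat) :
  (0 < x)%N -> (forall i, (i < s)%N -> nth 0%N la i = x) -> la = nseq s x ++ drop s la.
Proof.
move=> x0 H; rewrite -[LHS](cat_take_drop s); congr (_ ++ _).
(* Past the end [nth] returns 0, so [0 < x] forces the first [s] entries to be present. *)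
have szl : (s <= size la)%N.
  case: s H => // s H; rewrite ltnNge; apply/negP => sl.
  by move: (H s (ltnSn s)); rewrite nth_default // => x0'; rewrite -x0' in x0.
apply: (@eq_from_nth _ 0%N); rewrite size_takel ?size_nseq // => i ils.
by rewrite nth_take // nth_nseq ils H.
Qed.

Lemma card_ord_ltn n n0 : (n0 <= n)%N -> #|[set i : 'I_n | (i < n0)%N]| = n0.
Proof.
move=> le; rewrite cardsE cardE -(size_map val) -[RHS](size_iota 0); apply/perm_size/uniq_perm.
- by rewrite map_inj_uniq ?enum_uniq //; apply: val_inj.
- exact: iota_uniq.
move=> j; rewrite mem_iota; apply/mapP/idP => [[i + ->]|jn]; first by rewrite mem_enum.
by exists (Ordinal (leq_trans jn le)); rewrite ?mem_enum.
Qed.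

Lemma card_ord_geq n n0 : (n0 <= n)%N -> #|[set i : 'I_n | (n0 <= i)%N]| = (n - n0)%N.
Proof.
move=> le; rewrite -[in RHS](card_ord_ltn le) cardsCs card_ord; congr (_ - _)%N.
by apply: eq_card => i; rewrite !inE -ltnNge.
Qed.

Lemma crossing_ge n n0 (i l : 'I_n) : (n0 <= i)%N -> crossing n0 i l = false.
Proof. by move=> ni; rewrite /crossing ltnNge ni. Qed.

Lemma crossing_lt n n0 (i l : 'I_n) : (i < n0)%N -> crossing n0 i l = (n0 <= l)%N.
Proof. by move=> ni; rewrite /crossing ni -leqNgt. Qed.

Lemma cross_ge n n0 (A : {set 'I_n}) (i : 'I_n) : (n0 <= i)%N -> cross n0 A i = 0%N.
Proof. by move=> ni; rewrite /cross big1 // => l _; rewrite crossing_ge. Qed.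

Lemma cross_lt n n0 (A : {set 'I_n}) (i : 'I_n) : (i < n0)%N ->
  cross n0 A i = #|[set l in A | (n0 <= l)%N]|.
Proof.
move=> ni; rewrite /cross (eq_bigr _ (fun l _ => congr1 nat_of_bool (crossing_lt l ni))).
rewrite -big_mkcondr -[RHS]sum1_card; apply: eq_bigl => l; rewrite !inE.
by have [->|] := eqVneq l i; rewrite //= leqNgt ni andbF.
Qed.

(** Otherwise every [f i] would lie strictly below [r], as does the neutral element -oo. *)
Lemma bigmaxe_attained n (P : pred 'I_n) (f : 'I_n -> int) (r : int) :
  (\big[maxe/-oo]_(i < n | P i) (f i)%:E)%E = r%:E -> exists2 i, P i & f i = r.
Proof.
move=> e; apply/exists_eq_inP; rewrite -[X in is_true X]negbK negb_exists_in.
apply/negP => /forall_inP H; suff: (\big[maxe/-oo]_(i < n | P i) (f i)%:E < r%:E)%E.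
  by rewrite e ltxx.
apply: bigmax_lt => [|i Pi]; first exact: ltNyr.
by rewrite lt_neqAle eqe H //= -e; apply: le_bigmax_cond.
Qed.

Lemma shifted_bound (x : int) (n n0 r : nat) : (n0 <= n)%N -> x - n%:Z + n0%:Z <= r%:Z ->
  (x <= (r + (n - n0))%:Z) && ((x == (r + (n - n0))%:Z) == (x - n%:Z + n0%:Z == r%:Z)).
Proof. by move=> ? ?; apply/andP; split; lia. Qed.

Lemma strict_bound (x : int) (k s r : nat) : x + s%:Z <= r%:Z -> (k < s)%N ->
  (x + k%:Z <= r%:Z) && ((x + k%:Z == r%:Z) == false).
Proof. by move=> ? ?; apply/andP; split; lia. Qed.

(** Here [k] counts the deletions made so far; [s <= n - n0] keeps the truncated subtraction
    [n - n0 - k] exact. *)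
Lemma strict_shifted_bound (x : int) (n n0 k s r : nat) : (n0 <= n)%N -> (s <= n - n0)%N ->
  x - n%:Z + n0%:Z + s%:Z <= r%:Z -> (k < s)%N ->
  (x <= (r + (n - n0 - k))%:Z) && ((x == (r + (n - n0 - k))%:Z) == false).
Proof. by move=> ? ? ? ?; apply/andP; split; lia. Qed.

Theorem theorem1p3 (F : fieldType) (q : F) (q_neq0 : q != 0)
    (q_order : forall k : nat, (0 < k)%N -> q ^+ k != 1)
    (n : nat) (n_gt0 : (0 < n)%N) (n0 : nat) (n0_le_n : (n0 <= n)%N)
    (a : n.-tuple nat) (a_gt0 : forall i, (0 < tnth a i)%N)
    (v : n.-tuple int)
    (la : seq nat) (la_part : sorted geq la)
    (la_v : (sumn la)%:Z = \sum_(i < n) tnth v i) :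
  let m1 : \bar int :=
    (\big[maxe/-oo]_(i < n | (i < n0)%N) (tnth v i - n%:Z + n0%:Z)%R%:E)%E in
  let m2 : \bar int :=
    (\big[maxe/-oo]_(i < n | (n0 <= i)%N) (tnth v i)%:E)%E in
  let r : int := fine (maxe m1 m2) in
  let S1 := [set i : 'I_n | (i < n0)%N && (tnth v i - n%:Z + n0%:Z == r)] in
  let S2 := [set i : 'I_n | (n0 <= i)%N && (tnth v i == r)] in
  let s1 := #|S1| in
  let s2 := #|S2| in
  let ta : n.-tuple nat := [tuple (tnth a i - (i < n0))%N | i < n] in
  0 < r ->
  ((m2 + s1%:Z%:E <= m1)%E ->
   (forall i, (i < s1)%N -> (nth 0%N la i)%:Z = r) ->
   dysonD q n n0 a v la =
   (-1) ^+ (s1 * (n - n0))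
   * (qmultinomial q (sumn ta + `|r - 1|) (rcons ta `|r - 1|%N)
      / qmultinomial q (sumn ta - subsum S1 ta + `|r - 1|)
          (rcons (delete S1 ta) `|r - 1|%N))
   * (\sum_(J : {set 'I_n} | (J != set0) && (J \subset S1))
        (-1) ^+ #|S1 :\: J| * q ^+ Lsum n0 S1 J ta
        * ((1 - q ^+ subsum J ta) / (1 - q ^+ (sumn ta - subsum J ta + `|r|)))
        * dysonD q (n - s1) (n0 - s1) (delete S1 a)
            (delete S1 [tuple tnth v i + s1%:Z * (n0 <= i)%N%:Z | i < n])
            (drop s1 la)))
  /\
  ((m1 + s2%:Z%:E <= m2)%E ->
   (forall i, (i < s2)%N -> (nth 0%N la i)%:Z = r) ->
   dysonD q n n0 a v la =
   qmultinomial q (sumn ta + `|r - 1|) (rcons ta `|r - 1|%N)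
   / qmultinomial q (sumn ta - subsum S2 ta + `|r - 1|)
       (rcons (delete S2 ta) `|r - 1|%N)
   * (\sum_(J : {set 'I_n} | (J != set0) && (J \subset S2))
        (-1) ^+ #|S2 :\: J| * q ^+ Lsum n S2 J ta
        * ((1 - q ^+ subsum J ta) / (1 - q ^+ (sumn ta - subsum J ta + `|r|)))
        * dysonD q (n - s2) n0 (delete S2 a) (delete S2 v) (drop s2 la))).
Proof.
move=> m1 m2 r S1 S2 s1 s2 ta r_gt0.
(* [fine] sends the infinities to 0, so [0 < r] makes the maximum finite. *)
have maxE : maxe m1 m2 = r%:E.
  by rewrite /r; case: (maxe m1 m2) (r_gt0 : 0 < fine (maxe m1 m2)).
have le1 (i : 'I_n) : (i < n0)%N -> ((tnth v i - n%:Z + n0%:Z)%R%:E <= m1)%E.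
  by move=> i0; apply: le_bigmax_cond.
have le2 (i : 'I_n) : (n0 <= i)%N -> ((tnth v i)%:E <= m2)%E.
  by move=> i0; apply: le_bigmax_cond.
have m1r : (m1 <= r%:E)%E by rewrite -maxE le_max lexx.
have m2r : (m2 <= r%:E)%E by rewrite -maxE le_max lexx orbT.
have [r' rE] : exists r' : nat, r = r'.+1%:Z.
  by case: (r) r_gt0 => // -[//|r'] _; exists r'.
have -> : `|r - 1|%N = r' by rewrite rE -addn1 PoszD addrK.
have -> : `|r|%N = r'.+1 by rewrite rE.
have S1n0 i : i \in S1 -> (i < n0)%N by rewrite inE => /andP[].
have S2n0 i : i \in S2 -> (n0 <= i)%N by rewrite inE => /andP[].
have remaining_mem (S U : {set 'I_n}) i : U \subset S -> i \in remaining S U ->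
    (i \in U) = (i \in S).
  move=> US; rewrite !inE negb_and negbK => /orP[iU|iS]; first by rewrite iU (subsetP US).
  by rewrite (negPf iS); apply: contraNF iS => /(subsetP US).
have removed_card (S U : {set 'I_n}) : U \subset S -> U != set0 -> (#|S :\: U| < #|S|)%N.
  move=> US U0; rewrite -(cardsID U S) (setIidPr US) -[X in (X < _)%N]add0n ltn_add2r.
  by rewrite card_gt0.
split=> m12 la_r.
- have S1_neq0 : S1 != set0.
    have m21 : (m2 <= m1)%E by apply: le_trans m12; rewrite leeDl // lee_fin.
    move: maxE; rewrite max_l // => /bigmaxe_attained[i i0 vi].
    by apply/set0Pn; exists i; rewrite inE i0 vi eqxx.
  have le2s (i : 'I_n) : (n0 <= i)%N -> tnth v i + s1%:Z <= r.
    move=> i0; rewrite -lee_fin EFinD; apply: le_trans m1r; apply: le_trans m12.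
    exact: leeD2r (le2 i i0).
  have cross1 (U : {set 'I_n}) (i : 'I_n) : (i < n0)%N -> cross n0 (remaining S1 U) i = (n - n0)%N.
    move=> i0; rewrite cross_lt // -card_ord_geq //; apply: eq_card => l.
    by rewrite !in_set; case: leqP => nl; rewrite ?andbF ?andbT.
  rewrite {1}(@nseq_cat_drop s1 r'.+1 la) //; last first.
    by move=> i /la_r; rewrite rE => -[].
  (* For [i < n0] the pair [(i, l)] crosses exactly when [n0 <= l]: this gives the cut-off [n0], the
     count [n - n0] and the shift of the second block. *)
  apply: (@dysonD_eliminate F q q_neq0 q_order n n0 (n0 - s1) n0 r' (n - n0) a v _
            (fun l => (n0 <= l)%N)) => //.
  + have sub : S1 \subset [set i : 'I_n | (i < n0)%N].
      by apply/subsetP => i /S1n0; rewrite inE.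
    transitivity #|[set i : 'I_n | (i < n0)%N] :\: S1|.
      by apply: eq_card => i; rewrite in_setD !in_set.
    by rewrite cardsD (setIidPr sub) card_ord_ltn.
  + by move=> l; rewrite tnth_mktuple PoszM.
  + by move=> i /S1n0 i0 l; rewrite crossing_lt.
  + by move=> i /S1n0 i0 l; rewrite crossing_lt // -ltnNge.
  + by move=> U US i /(subsetP US) /S1n0 i0; apply: cross1.
  move=> U US U0 i iA; have iUS := remaining_mem _ _ _ US iA.
  have [i0|i0] := ltnP i n0.
    rewrite /exponents leqNgt i0 /= muln0 addr0 cross1 // iUS inE i0 /=.
    by have := le_trans (le1 i i0) m1r; rewrite lee_fin rE; apply: shifted_bound.
  have iU : i \notin U by apply: contraL i0 => /(subsetP US) /S1n0; rewrite -ltnNge.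
  rewrite /exponents i0 muln1 cross_ge // addn0 (negPf iU).
  by have := le2s i i0; rewrite rE => /strict_bound; apply; apply: removed_card.
have S2_neq0 : S2 != set0.
  have m21 : (m1 <= m2)%E by apply: le_trans m12; rewrite leeDl // lee_fin.
  move: maxE; rewrite max_r // => /bigmaxe_attained[i i0 vi].
  by apply/set0Pn; exists i; rewrite inE i0 vi eqxx.
have le1s (i : 'I_n) : (i < n0)%N -> tnth v i - n%:Z + n0%:Z + s2%:Z <= r.
  move=> i0; rewrite -lee_fin EFinD; apply: le_trans m2r; apply: le_trans m12.
  exact: leeD2r (le1 i i0).
have cross2 (U : {set 'I_n}) (i : 'I_n) : U \subset S2 -> (i < n0)%N ->
    cross n0 (remaining S2 U) i = (n - n0 - #|S2 :\: U|)%N.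
  move=> US i0; rewrite cross_lt // -(card_ord_geq n0_le_n).
  rewrite -(cardsID (S2 :\: U) [set i : 'I_n | (n0 <= i)%N]).
  have sub : S2 :\: U \subset [set i : 'I_n | (n0 <= i)%N].
    by apply/subsetP => j; rewrite in_setD => /andP[_ /S2n0]; rewrite inE.
  rewrite (setIidPr sub) addKn; apply: eq_card => l.
  by rewrite in_setD !in_set.
have s2_le : (s2 <= n - n0)%N.
  by rewrite -card_ord_geq //; apply/subset_leq_card/subsetP => j /S2n0; rewrite inE.
rewrite {1}(@nseq_cat_drop s2 r'.+1 la) //; last first.
  by move=> i /la_r; rewrite rE => -[].
(* No pair [(i, l)] with [n0 <= i] crosses, so there is no sign and no shift, and the cut-off is
   [n]. *)
rewrite (@dysonD_eliminate F q q_neq0 q_order n n0 n0 n r' 0 a v v (fun=> 0%N)) //.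
- by rewrite muln0 expr0 mul1r.
- rewrite -[RHS](card_ord_ltn n0_le_n); apply: eq_card => i; rewrite !in_set.
  by rewrite negb_and; case: ltnP => //; rewrite ?andbF.
- by move=> l; rewrite muln0 addr0.
- by move=> i /S2n0 i0 l; rewrite crossing_ge.
- by move=> i /S2n0 i0 l; rewrite crossing_ge // andbT ltn_ord andbT.
- by move=> U US i /(subsetP US) /S2n0 i0; apply: cross_ge.
move=> U US U0 i iA; have iUS := remaining_mem _ _ _ US iA.
rewrite /exponents muln0 addr0; have := removed_card _ _ US U0; rewrite -/s2 => cU.
have [i0|i0] := ltnP i n0.
  have iU : i \notin U by apply: contraL i0 => /(subsetP US) /S2n0; rewrite -leqNgt.
  rewrite cross2 // (negPf iU).
  by have := le1s i i0; rewrite rE => /strict_shifted_bound; apply.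
rewrite cross_ge // addn0 iUS inE i0 /= rE eqxx andbT.
by have := le_trans (le2 i i0) m2r; rewrite lee_fin rE.
Qed.
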